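(* Let $X\subset\mathbb{R}^N$ be a bounded open set and let $\Theta$ be a uniformly continuous proper elliptic map on $X$. If $u,\tilde u\in\mathrm{USC}(\overline{X})$, $u$ is $\Theta$-subharmonic in $X$ and $\tilde u$ is $\tilde\Theta$-subharmonic in $X$, then $u+\tilde u$ is $\tilde{\mathcal{Q}}$-subharmonic in $X$.
   Context: $\mathcal{S}(N)$ is the space of real symmetric $N\times N$ matrices with the usual partial order; $\lambda_1(A)\le\dots\le\lambda_N(A)$ are the ordered eigenvalues; $I$ is the identity. $\mathcal{Q}:=\{(s,P): s\le 0,\ P\ge 0\}\subset\mathbb{R}\times\mathcal{S}(N)$ and $\tilde{\mathcal{Q}}:=\{(r,A)\in\mathbb{R}\times\mathcal{S}(N): r\le 0\text{ or }\lambda_N(A)\ge 0\}$. A map $\Theta$ from $X$ to subsets of $\mathbb{R}\times\mathcal{S}(N)$ is a proper elliptic map if each $\Theta(x)$ is closed, nonempty, not all of $\mathbb{R}\times\mathcal{S}(N)$, and $\Theta(x)+\mathcal{Q}\subset\Theta(x)$. Its dual map is $\tilde\Theta(x):=-\big[(\mathbb{R}\times\mathcal{S}(N))\setminus(\Theta(x))^\circ\big]$. For $u$ defined near $x_0$, $J^+_{x_0}u:=\{(\varphi(x_0),D^2\varphi(x_0)):\varphi$ is $C^2$ near $x_0$, $u\le\varphi$ near $x_0$, $u(x_0)=\varphi(x_0)\}$. For a map $\Psi$ (possibly constant, e.g. $\Psi\equiv\tilde{\mathcal Q}$), $w\in\mathrm{USC}(X)$ is $\Psi$-subharmonic in $X$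 if $J^+_{x_0}w\subset\Psi(x_0)$ for all $x_0\in X$. With the norm $\|(r,A)\|=\max\{|r|,\max_i|\lambda_i(A)|\}$ and the associated Hausdorff distance $d_{\mathcal H}$ on closed subsets of $\mathbb{R}\times\mathcal{S}(N)$ (possibly $+\infty$), $\Theta$ is uniformly continuous on $X$ if for every $\eta>0$ there is $\delta>0$ such that $d_{\mathcal H}(\Theta(x),\Theta(y))<\eta$ for all $x,y\in X$ with $|x-y|<\delta$. *)

(* Defs.v *)
From HB Require Import structures.
From mathcomp Require Import all_boot all_order all_algebra.
From mathcomp Require Import all_classical all_reals all_analysis.
Set Implicit Arguments. Unset Strict Implicit. Unset Printing Implicit Defensive.
Import Order.TTheory GRing.Theory Num.Theory.
Import numFieldNormedType.Exports.
Local Open Scope classical_set_scope.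
Local Open Scope ring_scope.

Section Defs.
Variables (R : realType) (N : nat).

Definition enorm (x : 'rV[R]_N) : R := Num.sqrt (\sum_(i < N) x ord0 i ^+ 2).

Definition ebounded (X : set 'rV[R]_N) : Prop :=
  exists M : R, forall x, X x -> enorm x <= M.

(** Symmetric matrices; the space R x S(N) is the set SN of pairs (r, A)
    with A symmetric. *)
Definition symmx (A : 'M[R]_N) : Prop := A^T = A.
Definition SN : set (R * 'M[R]_N) := [set p | symmx p.2].

Definition psd (P : 'M[R]_N) : Prop :=
  symmx P /\ forall v : 'rV[R]_N, 0 <= (v *m P *m v^T) ord0 ord0.

Definition eigs (A : 'M[R]_N) : set R := [set a | eigenvalue A a].
Definition lamN (A : 'M[R]_N) : R := sup (eigs A).

Definition padd (p q : R * 'M[R]_N) : R * 'M[R]_N := (p.1 + q.1, p.2 + q.2).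
Definition pneg (p : R * 'M[R]_N) : R * 'M[R]_N := (- p.1, - p.2).
Definition psub (p q : R * 'M[R]_N) : R * 'M[R]_N := padd p (pneg q).

Definition normRS (p : R * 'M[R]_N) : R :=
  sup ([set `|p.1|] `|` [set `|a| | a in eigs p.2]).

Definition Qcone : set (R * 'M[R]_N) := [set p | p.1 <= 0 /\ psd p.2].
Definition Qtilde : set (R * 'M[R]_N) := [set p | SN p /\ (p.1 <= 0 \/ 0 <= lamN p.2)].

Definition relint (S : set (R * 'M[R]_N)) : set (R * 'M[R]_N) :=
  [set p | SN p /\ exists e : R, 0 < e /\
     forall q, SN q -> normRS (psub q p) < e -> S q].
Definition relclosed (S : set (R * 'M[R]_N)) : Prop :=
  S `<=` SN /\
  forall p, SN p -> (forall e : R, 0 < e -> exists q, S q /\ normRS (psub q p) < e) -> S p.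

Definition proper_elliptic (X : set 'rV[R]_N) (Th : 'rV[R]_N -> set (R * 'M[R]_N)) : Prop :=
  forall x, X x ->
    [/\ relclosed (Th x), Th x !=set0, Th x <> SN &
        forall p q, Th x p -> Qcone q -> Th x (padd p q)].

Definition dual (Th : 'rV[R]_N -> set (R * 'M[R]_N)) (x : 'rV[R]_N) : set (R * 'M[R]_N) :=
  pneg @` (SN `\` relint (Th x)).

Definition pdist (p : R * 'M[R]_N) (T : set (R * 'M[R]_N)) : \bar R :=
  ereal_inf [set (normRS (psub p q))%:E | q in T].
Definition hausdorff (S T : set (R * 'M[R]_N)) : \bar R :=
  maxe (ereal_sup [set pdist p T | p in S]) (ereal_sup [set pdist q S | q in T]).

Definition unif_cont_on (X : set 'rV[R]_N) (Th : 'rV[R]_N -> set (R * 'M[R]_N)) : Prop :=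
  forall eta : R, 0 < eta -> exists delta : R, 0 < delta /\
    forall x y, X x -> X y -> enorm (x - y) < delta ->
      (hausdorff (Th x) (Th y) < eta%:E)%E.

Definition usc_on (D : set 'rV[R]_N) (u : 'rV[R]_N -> \bar R) : Prop :=
  (forall x, D x -> u x != +oo%E) /\
  forall x, D x -> forall a : R, (u x < a%:E)%E ->
    \forall y \near x, D y -> (u y < a%:E)%E.

Definition evec (i : 'I_N) : 'rV[R]_N := delta_mx ord0 i.
Definition pd (i : 'I_N) (f : 'rV[R]_N -> R) : 'rV[R]_N -> R :=
  fun x => derive f x (evec i).

Definition C2_near (phi : 'rV[R]_N -> R) (x0 : 'rV[R]_N) : Prop :=
  exists U : set 'rV[R]_N, [/\ open U, U x0 &
    forall x, U x ->
      [/\ {for x, continuous phi},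
          forall i, derivable phi x (evec i) /\ {for x, continuous (pd i phi)} &
          forall i j, derivable (pd i phi) x (evec j) /\
                      {for x, continuous (pd j (pd i phi))}]].

Definition hessian (phi : 'rV[R]_N -> R) (x : 'rV[R]_N) : 'M[R]_N :=
  \matrix_(i, j) pd j (pd i phi) x.

Definition Jplus (u : 'rV[R]_N -> \bar R) (x0 : 'rV[R]_N) : set (R * 'M[R]_N) :=
  [set p | exists phi : 'rV[R]_N -> R,
     [/\ C2_near phi x0,
         \forall x \near x0, (u x <= (phi x)%:E)%E,
         u x0 = (phi x0)%:E &
         p = (phi x0, hessian phi x0)]].

Definition subharmonic (Psi : 'rV[R]_N -> set (R * 'M[R]_N)) (X : set 'rV[R]_N)
    (w : 'rV[R]_N -> \bar R) : Prop :=
  usc_on X w /\ forall x0, X x0 -> Jplus w x0 `<=` Psi x0.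

End Defs.

(* Main.v *)
(** If the conclusion fails at [x0], a test function gives [u + ut <= r + linear -
    c |x - x0|^2] near [x0], with equality at [x0] and [r > 0].  Jets carry no gradient and
    [Theta] is uniformly continuous uniformly in the jets, so it is enough to find, at two
    points [z1], [z2] near [x0], quadratics with Hessians [A], [B] touching [u] and [ut]
    from above with [A + B < 0] and [u z1 + ut z2 > 0].  Sup-convolution makes [u] and [ut]
    semiconvex functions [f] and [g] and only translates the touching quadratics.

    Alexandrov's theorem is avoided as follows.  Let [K] be the set of points at which
    [f + g] lies below an affine function of small slope touching it there.  By
    semiconvexity the slope is a Lipschitz function of the point of [K], and all small
    slopes occur, so a counting argument shows that [K] is not porous: some cube has all of
    its [M ^ N] subcubes meeting [K].  Inside that cube, take a quadratic touching [f] from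
    above on a ball.  By a quantitative strong maximum principle (with an exponential
    barrier), either [f] is within [delta * radius^2] of the quadratic, or [f] is touched
    on a ball of comparable radius by a quadratic whose Hessian has smaller trace.  Traces
    are bounded below, so after boundedly many steps [f] is almost a quadratic of Hessian
    [A] on some ball, which contains points of [K]; there [g] is at most an affine function
    minus [f], hence is touched from above by a quadratic of Hessian close to [- A]. *)
Require Import Defs.
From HB Require Import structures.
From mathcomp Require Import all_boot all_order all_algebra.
From mathcomp Require Import all_classical all_reals all_analysis.
From mathcomp Require Import ring lra zify.
Set Implicit Arguments. Unset Strict Implicit. Unset Printing Implicit Defensive.
Import Order.TTheory GRing.Theory Num.Theory.
Import numFieldNormedType.Exports.
Local Open Scope classical_set_scope.
Local Open Scope ring_scope.

(** * Euclidean inner product and quadratic forms on row vectors *)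

Section EuclideanSpace.
Context {R : realType} {N : nat}.
Implicit Types (x y z d v : 'rV[R]_N) (A B : 'M[R]_N).

Definition dot x y : R := \sum_i x ord0 i * y ord0 i.
Definition form A v : R := dot (v *m A) v.
Definition sqn v : R := dot v v.

Lemma dotC x y : dot x y = dot y x.
Proof. by apply: eq_bigr => i _; rewrite mulrC. Qed.

Lemma dotDl x y z : dot (x + y) z = dot x z + dot y z.
Proof. by rewrite -big_split; apply: eq_bigr => i _; rewrite mxE mulrDl. Qed.

Lemma dotZl a x y : dot (a *: x) y = a * dot x y.
Proof. by rewrite /dot mulr_sumr; apply: eq_bigr => i _; rewrite mxE mulrA. Qed.

Lemma dotNl x y : dot (- x) y = - dot x y.
Proof. by rewrite -scaleN1r dotZl mulN1r. Qed.

Lemma dotDr x y z : dot z (x + y) = dot z x + dot z y.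
Proof. by rewrite dotC dotDl !(dotC _ z). Qed.

Lemma dotZr a x y : dot x (a *: y) = a * dot x y.
Proof. by rewrite dotC dotZl dotC. Qed.

Lemma dotNr x y : dot x (- y) = - dot x y.
Proof. by rewrite dotC dotNl dotC. Qed.

Lemma dot0l x : dot 0 x = 0.
Proof. by rewrite -(scale0r 0) dotZl mul0r. Qed.

Lemma dot0r x : dot x 0 = 0.
Proof. by rewrite dotC dot0l. Qed.

Definition dotE := (dotDl, dotDr, dotNl, dotNr, dotZl, dotZr, dot0l, dot0r).

Lemma dot_evec x i : dot x (evec R i) = x ord0 i.
Proof.
rewrite /dot (bigD1 i) //= big1 ?addr0 => [|j /negPf ji].
  by rewrite mxE !eqxx mulr1.
by rewrite mxE eqxx ji mulr0.
Qed.

Lemma sqn_ge0 v : 0 <= sqn v.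
Proof. by apply: sumr_ge0 => i _; rewrite -expr2 sqr_ge0. Qed.

Lemma sqn_eq0 v : sqn v = 0 -> v = 0.
Proof.
move/psumr_eq0P => h; apply/rowP => i; rewrite mxE.
have := h _ i isT; move/(_ (fun j _ => _)) => /=.
by move=> h'; apply/eqP; rewrite -sqrf_eq0 expr2 h' // => j; rewrite -expr2 sqr_ge0.
Qed.

Lemma sqn_gt0 v : v != 0 -> 0 < sqn v.
Proof. by move=> v0; rewrite lt_def sqn_ge0 andbT; apply: contraNN v0 => /eqP/sqn_eq0->. Qed.

Lemma sqn0 : sqn 0 = 0.
Proof. exact: dot0l. Qed.

Lemma sqnZ a v : sqn (a *: v) = a ^+ 2 * sqn v.
Proof. by rewrite /sqn !dotE expr2 mulrA. Qed.

Lemma sqnN v : sqn (- v) = sqn v.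
Proof. by rewrite /sqn !dotE opprK. Qed.

Lemma sqnD x y : sqn (x + y) = sqn x + 2 * dot x y + sqn y.
Proof. by rewrite /sqn !dotE (dotC y x); ring. Qed.

Lemma sqnB x y : sqn (x - y) = sqn x - 2 * dot x y + sqn y.
Proof. by rewrite sqnD sqnN dotNr; ring. Qed.

Lemma sqn_evec i : sqn (evec R i : 'rV[R]_N) = 1.
Proof. by rewrite /sqn dot_evec mxE !eqxx. Qed.

(** Cauchy-Schwarz: expand the square of [sqn y *: x - dot x y *: y] and divide by [sqn y]. *)
Lemma dot_sqr_le x y : (dot x y) ^+ 2 <= sqn x * sqn y.
Proof.
have [->|y0] := eqVneq y 0; first by rewrite dot0r sqn0 mulr0 expr0n.
have yp := sqn_gt0 y0.
have := sqn_ge0 (sqn y *: x - dot x y *: y).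
rewrite sqnB !sqnZ !dotE => h.
have {h} : 0 <= sqn y * (sqn x * sqn y - dot x y ^+ 2) by nra.
by rewrite pmulr_rge0 // subr_ge0.
Qed.

Lemma sqr_dot_le x y (a b : R) : 0 <= a -> 0 <= b ->
  sqn x <= a ^+ 2 -> sqn y <= b ^+ 2 -> `|dot x y| <= a * b.
Proof.
move=> a0 b0 xa yb; rewrite -(@ler_pXn2r _ 2) ?nnegrE ?mulr_ge0 //.
rewrite real_normK ?num_real // (le_trans (dot_sqr_le x y)) // exprMn.
by rewrite ler_pM ?sqn_ge0.
Qed.

(** The triangle inequality in squared form. Euclidean balls are written throughout as
    [sqn v <= r ^+ 2], which avoids square roots. *)
Lemma sqn_triangle x y (a b : R) : 0 <= a -> 0 <= b ->
  sqn x <= a ^+ 2 -> sqn y <= b ^+ 2 -> sqn (x + y) <= (a + b) ^+ 2.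
Proof.
move=> a0 b0 xa yb; have := sqr_dot_le a0 b0 xa yb.
by rewrite ler_norml => /andP[_ h]; rewrite sqnD; lra.
Qed.

Lemma normr_coord v i : `|v ord0 i| <= `|v|.
Proof.
rewrite [leRHS]/Num.norm /= mx_normrE; apply/bigmax_geP; right => /=.
by exists (ord0, i).
Qed.

Lemma normr_rV_le v (a : R) : 0 <= a -> (forall i, `|v ord0 i| <= a) -> `|v| <= a.
Proof.
move=> a0 h; rewrite [leLHS]/Num.norm /= mx_normrE; apply/bigmax_leP.
by split => // -[i j] _ /=; rewrite (ord1 i).
Qed.

(** The library norm on row vectors is the sup norm; this passes from Euclidean bounds to the
    library topology. *)
Lemma norm_le_sqn v (a : R) : 0 <= a -> sqn v <= a ^+ 2 -> `|v| <= a.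
Proof.
move=> a0 va; apply: normr_rV_le => // i.
rewrite -(@ler_pXn2r _ 2) ?nnegrE // real_normK ?num_real //.
apply: le_trans va; rewrite /sqn /dot (bigD1 i) //= -expr2 lerDl.
by apply: sumr_ge0 => j _; rewrite -expr2 sqr_ge0.
Qed.

Lemma formE A v : form A v = (v *m A *m v^T) ord0 ord0.
Proof. by rewrite mxE; apply: eq_bigr => i _; rewrite [v^T _ _]mxE. Qed.

Lemma form_add A B v : form (A + B) v = form A v + form B v.
Proof. by rewrite /form mulmxDr dotDl. Qed.

Lemma form_opp A v : form (- A) v = - form A v.
Proof. by rewrite /form mulmxN dotNl. Qed.

Lemma form_scale a A v : form (a *: A) v = a * form A v.
Proof. by rewrite /form -scalemxAr dotZl. Qed.

Lemma form_scalar (a : R) v : form a%:M v = a * sqn v.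
Proof. by rewrite /form mul_mx_scalar dotZl. Qed.

Lemma formZ A a v : form A (a *: v) = a ^+ 2 * form A v.
Proof. by rewrite /form -scalemxAl dotZl dotZr mulrA. Qed.

Lemma form_oppv A v : form A (- v) = form A v.
Proof. by rewrite -scaleN1r formZ sqrrN expr1n mul1r. Qed.

Lemma dot_mulmxr A x y : dot (x *m A) y = dot x (y *m A^T).
Proof.
rewrite /dot; under eq_bigr do rewrite mxE mulr_suml.
rewrite exchange_big; apply: eq_bigr => i _; rewrite mxE mulr_sumr.
by apply: eq_bigr => j _; rewrite mxE -mulrA (mulrC (A i j)).
Qed.

Lemma dot_sym A x y : symmx A -> dot (x *m A) y = dot (y *m A) x.
Proof. by move=> sA; rewrite dot_mulmxr sA dotC. Qed.

Lemma formD A x y : symmx A ->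
  form A (x + y) = form A x + 2 * dot (x *m A) y + form A y.
Proof.
move=> sA; rewrite /form mulmxDl !dotE (dot_sym y x sA); ring.
Qed.

Lemma form_evec A i : form A (evec R i) = A i i.
Proof. by rewrite /form dot_evec -rowE mxE. Qed.

Lemma form_rank1 (b v : 'rV[R]_N) : form (b^T *m b) v = (dot b v) ^+ 2.
Proof.
rewrite /form mulmxA.
have -> : v *m b^T = (dot b v)%:M.
  apply/matrixP => i j; rewrite (ord1 i) (ord1 j) !mxE eqxx mulr1n.
  by apply: eq_bigr => k _; rewrite mxE mulrC.
by rewrite mul_scalar_mx dotZl.
Qed.

Lemma symmx_rank1 (b : 'rV[R]_N) : symmx (b^T *m b).
Proof. by rewrite /symmx trmx_mul trmxK. Qed.

Lemma mxtrace_rank1 (b : 'rV[R]_N) : \tr (b^T *m b) = sqn b.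
Proof.
by rewrite /mxtrace; apply: eq_bigr => i _; rewrite mxE big_ord1 mxE.
Qed.

Lemma symmx_scalar (a : R) : symmx (a%:M : 'M[R]_N).
Proof. exact: tr_scalar_mx. Qed.

Lemma symmxD A B : symmx A -> symmx B -> symmx (A + B).
Proof. by rewrite /symmx linearD /= => -> ->. Qed.

Lemma symmxN A : symmx A -> symmx (- A).
Proof. by rewrite /symmx linearN /= => ->. Qed.

Lemma symmxZ a A : symmx A -> symmx (a *: A).
Proof. by rewrite /symmx linearZ /= => ->. Qed.

Lemma mxtrace_ge A (c : R) : (forall v, - c * sqn v <= form A v) ->
  - (N%:R * c) <= \tr A.
Proof.
move=> h; rewrite /mxtrace -[X in X%:R]card_ord mulr_natl -sumr_const -sumrN.
by apply: ler_sum => i _; have := h (evec R i); rewrite form_evec sqn_evec mulr1.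
Qed.

(* The off-diagonal entries are controlled by testing with e_i + e_j and e_i - e_j. *)
Lemma form_le_trace A v : symmx A -> (forall x, 0 <= form A x) ->
  form A v <= N%:R * \tr A * sqn v.
Proof.
move=> sA A0.
have d0 i : 0 <= A i i by rewrite -form_evec.
have dtr i : A i i <= \tr A.
  by rewrite /mxtrace (bigD1 i) //= lerDl sumr_ge0.
have ent i j : `|A i j| <= \tr A.
  have e : dot (evec R i *m A) (evec R j) = A i j by rewrite dot_evec -rowE mxE.
  have := A0 (evec R i + evec R j); have := A0 (evec R i - evec R j).
  rewrite !formD // form_oppv !form_evec dotNr e => h1 h2.
  by have := dtr i; have := dtr j; rewrite ler_norml; lra.
rewrite /form /dot.
apply: (@le_trans _ _ (\sum_j \sum_i \tr A * ((v ord0 i) ^+ 2 + (v ord0 j) ^+ 2) / 2)).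
  apply: ler_sum => j _; rewrite mxE mulr_suml; apply: ler_sum => i _.
  have := ent i j; rewrite ler_norml => /andP[h1 h2].
  have t0 : 0 <= \tr A by apply: sumr_ge0.
  set a := v _ _; set b := v _ _; set T := \tr A in h1 h2 t0 *.
  have p1 : 0 <= (T - A i j) * (a + b) ^+ 2 by rewrite mulr_ge0 ?sqr_ge0 ?subr_ge0.
  have p2 : 0 <= (T + A i j) * (a - b) ^+ 2 by rewrite mulr_ge0 ?sqr_ge0 //; lra.
  by nra.
have S : \sum_i v ord0 i ^+ 2 = sqn v by apply: eq_bigr => i _; rewrite expr2.
rewrite le_eqVlt; apply/orP; left; apply/eqP.
under eq_bigr => j _.
  under eq_bigr => i _ do rewrite -mulrA mulrC.
  rewrite -mulr_suml -mulr_suml big_split /= S sumr_const card_ord.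
  over.
rewrite -!mulr_suml big_split /= sumr_const card_ord.
rewrite sumrMnl S -[sqn v *+ N]mulr_natl; by field.
Qed.

Lemma mxtrace_scalar_rV (a : R) : \tr (a%:M : 'M[R]_N) = N%:R * a.
Proof. by rewrite mxtrace_scalar mulr_natl. Qed.

End EuclideanSpace.

(** * Continuity, maxima on compact sets, and extreme eigenvalues *)

Section Extrema.
Context {R : realType} {N : nat}.

Lemma continuous_funD (T : topologicalType) (f g : T -> R) :
  continuous f -> continuous g -> continuous (fun t => f t + g t).
Proof. by move=> cf cg t; apply: cvgD; [exact: cf|exact: cg]. Qed.

Lemma continuous_funM (T : topologicalType) (f g : T -> R) :
  continuous f -> continuous g -> continuous (fun t => f t * g t).
Proof. by move=> cf cg t; apply: cvgM; [exact: cf|exact: cg]. Qed.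

Lemma continuous_funN (T : topologicalType) (f : T -> R) :
  continuous f -> continuous (fun t => - f t).
Proof. by move=> cf t; apply: cvgN; exact: cf. Qed.

Lemma continuous_funC (T : topologicalType) (c : R) : continuous (fun _ : T => c).
Proof. by move=> t; exact: cvg_cst. Qed.

Lemma continuous_fun_expR (T : topologicalType) (f : T -> R) :
  continuous f -> continuous (fun t => expR (f t)).
Proof.
by move=> cf t; apply: continuous_comp; [exact: cf|exact: continuous_expR].
Qed.

Lemma continuous_sumr (T : topologicalType) (I : Type) (s : seq I) (f : I -> T -> R) :
  (forall i, continuous (f i)) -> continuous (fun x => \sum_(i <- s) f i x).
Proof.
move=> cf; elim: s => [|i s IHs] t.
  rewrite (_ : (fun x => _) = fun=> 0); first exact: cvg_cst.
  by apply/funext => x; rewrite big_nil.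
rewrite (_ : (fun x => _) = f i \+ (fun x => \sum_(j <- s) f j x)).
  by apply: cvgD; [exact: cf|exact: IHs].
by apply/funext => x; rewrite big_cons.
Qed.

Lemma continuous_dot (T : topologicalType) (f g : T -> 'rV[R]_N) :
  (forall i, continuous (fun t => f t ord0 i)) ->
  (forall i, continuous (fun t => g t ord0 i)) ->
  continuous (fun t => dot (f t) (g t)).
Proof.
by move=> cf cg; apply: continuous_sumr => i t; apply: cvgM; [exact: cf|exact: cg].
Qed.

Lemma continuous_form (A : 'M[R]_N) : continuous (form A).
Proof.
apply: continuous_dot => i; last exact: coord_continuous.
rewrite (_ : (fun t => _) = fun v : 'rV[R]_N => \sum_j v ord0 j * A j i).
  apply: continuous_sumr => j; apply: continuous_funM.
    exact: coord_continuous.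
  exact: continuous_funC.
by apply/funext => v; rewrite mxE.
Qed.

Lemma continuous_sqn : continuous (@sqn R N).
Proof. by apply: continuous_dot => ?; exact: coord_continuous. Qed.

Lemma continuous_coordB (x : 'rV[R]_N) i : continuous (fun y : 'rV[R]_N => (y - x) ord0 i).
Proof.
rewrite (_ : (fun y => _) = fun y : 'rV[R]_N => y ord0 i + (- x ord0 i)).
  by apply: continuous_funD; [exact: coord_continuous|exact: continuous_funC].
by apply/funext => y; rewrite !mxE.
Qed.

Lemma continuous_sqnB (x : 'rV[R]_N) : continuous (fun y : 'rV[R]_N => sqn (y - x)).
Proof. by apply: continuous_dot => i; exact: continuous_coordB. Qed.

Lemma continuous_dotB (b x : 'rV[R]_N) : continuous (fun y : 'rV[R]_N => dot b (y - x)).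
Proof.
by apply: continuous_dot => i; [exact: continuous_funC|exact: continuous_coordB].
Qed.

Lemma continuous_formB A (x : 'rV[R]_N) : continuous (fun y : 'rV[R]_N => form A (y - x)).
Proof.
apply: continuous_dot => i; last exact: continuous_coordB.
rewrite (_ : (fun t => _) = fun v : 'rV[R]_N => \sum_j (v - x) ord0 j * A j i).
  apply: continuous_sumr => j; apply: continuous_funM.
    exact: continuous_coordB.
  exact: continuous_funC.
by apply/funext => v; rewrite mxE.
Qed.

Lemma near_sqn (z : 'rV[R]_N) (r : R) : 0 < r ->
  \forall y \near z, sqn (y - z) <= r ^+ 2.
Proof.
move=> r0; have := @continuous_sqnB z z; move/cvgrPdist_lt/(_ (r ^+ 2)).
rewrite exprn_gt0 // => /(_ isT); apply: filterS => y.
by rewrite subrr sqn0 sub0r normrN ger0_norm ?sqn_ge0 //; exact: ltW.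
Qed.

Lemma bounded_set_norm (A : set 'rV[R]_N) (M : R) :
  (forall x, A x -> `|x| <= M) -> bounded_set A.
Proof.
move=> h; exists M; split; first by rewrite num_real.
by move=> K MK x Ax; exact: (le_trans (h _ Ax) (ltW MK)).
Qed.

Definition eball (x : 'rV[R]_N) (r : R) : set 'rV[R]_N :=
  [set y | sqn (y - x) <= r ^+ 2].

Lemma eball_center (x : 'rV[R]_N) (r : R) : eball x r x.
Proof. by rewrite /eball /= subrr sqn0 sqr_ge0. Qed.

Lemma compact_eball (x : 'rV[R]_N) (r : R) : compact (eball x r).
Proof.
apply: bounded_closed_compact.
  apply: (@bounded_set_norm _ (`|x| + `|r|)) => y yr.
  have h : `|y - x| <= `|r| by apply: norm_le_sqn => //; rewrite real_normK ?num_real.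
  rewrite -(subrK x y) addrC (le_trans (ler_normD _ _)) // lerD2l.
  exact: h.
have /continuous_closedP := @continuous_sqnB x.
by move/(_ [set t | t <= r ^+ 2]); apply; exact: closed_le.
Qed.

Lemma max_on_eball (f : 'rV[R]_N -> R) x (r : R) : continuous f ->
  exists2 c, sqn (c - x) <= r ^+ 2 & forall y, sqn (y - x) <= r ^+ 2 -> f y <= f c.
Proof.
move=> cf; have [|||c cB hc] := @EVT_max_rV R N f (eball x r).
- by exists x; exact: eball_center.
- exact: compact_eball.
- exact: continuous_subspaceT.
by exists c; [move: cB; rewrite inE|move=> y yr; apply: hc; rewrite inE].
Qed.

(* A maximizer of the Rayleigh quotient is an eigenvector: the nonnegative form
   m|.|^2 - A vanishes there, so its differential does too. *)
Lemma rayleigh_max (A : 'M[R]_N) : (0 < N)%N -> symmx A ->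
  exists2 m, eigenvalue A m & forall v, form A v <= m * sqn v.
Proof.
move=> N0 sA.
have cS : compact [set v : 'rV[R]_N | sqn v = 1].
  apply: bounded_closed_compact.
    by apply: (@bounded_set_norm _ 1) => v /= v1; apply: norm_le_sqn; rewrite ?v1 ?expr1n.
  have /continuous_closedP := continuous_sqn.
  by move/(_ [set 1]); apply; exact: closed_eq.
have [|v] := EVT_max_rV _ cS (continuous_subspaceT (@continuous_form A)).
  by exists (evec R (Ordinal N0)) => /=; rewrite sqn_evec.
rewrite inE /= => v1 vmax; set m := form A v in vmax.
have hP w : form A w <= m * sqn w.
  have [->|w0] := eqVneq w 0; first by rewrite /form mul0mx dot0r sqn0 mulr0.
  have wp := sqn_gt0 w0; set s := Num.sqrt (sqn w).
  have s0 : 0 < s by rewrite sqrtr_gt0.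
  have ss : s ^+ 2 = sqn w by rewrite sqr_sqrtr // ltW.
  have := vmax (s^-1 *: w); rewrite inE /= sqnZ formZ exprVn ss.
  rewrite mulVf ?gt_eqF // => /(_ erefl).
  by rewrite mulrC ler_pdivrMr.
exists m => //; apply/eigenvalueP; exists v; last first.
  by apply: contra_eq_neq v1 => ->; rewrite sqn0 eq_sym oner_eq0.
have lin w : dot (v *m A) w = m * dot v w.
  set q := dot (v *m A) w - m * dot v w.
  have h (t : R) : 2 * t * q <= t ^+ 2 * (m * sqn w - form A w).
    have := hP (v + t *: w).
    rewrite formD // sqnD !formZ !sqnZ v1 -/m !dotZr => h; rewrite /q; lra.
  set c := m * sqn w - form A w in h.
  have c0 : 0 <= c by rewrite subr_ge0.
  have h1 := h (q / (c + 1)).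
  have e : 2 * (q / (c + 1)) * q - (q / (c + 1)) ^+ 2 * c =
     (q / (c + 1)) ^+ 2 * (c + 2) by field; lra.
  have : (q / (c + 1)) ^+ 2 * (c + 2) <= 0 by lra.
  rewrite pmulr_lle0 ?ltr_wpDl // => h2.
  have : (q / (c + 1)) ^+ 2 == 0 by rewrite eq_le h2 sqr_ge0.
  rewrite sqrf_eq0 mulf_eq0 invr_eq0 (gt_eqF (ltr_wpDl c0 ltr01)) orbF.
  by rewrite subr_eq0 => /eqP.
apply/rowP => i; have := lin (evec R i).
by rewrite !dot_evec => ->; rewrite mxE.
Qed.

Lemma eigenvalueN (A : 'M[R]_N) a : eigenvalue (- A) a -> eigenvalue A (- a).
Proof.
move/eigenvalueP => [v va v0]; apply/eigenvalueP; exists v => //.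
by rewrite scaleNr -va mulmxN opprK.
Qed.

(** [sup] takes a default value on unbounded sets, so [lamN] and [normRS] are genuine suprema only
    thanks to this bound. It is read off at a coordinate of largest modulus of an eigenvector. *)
Lemma eigs_bounded (A : 'M[R]_N) : exists e, forall a, eigs A a -> `|a| <= e.
Proof.
exists (\sum_i \sum_j `|A i j|) => a /eigenvalueP[v va v0].
have [i vi] : exists i, `|v| <= `|v ord0 i|.
  have : mx_norm v != 0 by apply: contra v0 => /eqP/mx_norm_eq0/eqP.
  by case/mx_norm_neq0 => -[k i] /=; rewrite (ord1 k) => e; exists i; rewrite -e.
have np : 0 < `|v ord0 i| by rewrite (lt_le_trans _ vi) // normr_gt0.
rewrite -(ler_pM2r np) -normrM.
have -> : a * v ord0 i = (v *m A) ord0 i by rewrite va mxE.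
rewrite mxE (le_trans (ler_norm_sum _ _ _)) // mulr_suml; apply: ler_sum => j _.
rewrite normrM mulrC ler_pM //; last by rewrite (le_trans (normr_coord _ _)).
by rewrite (bigD1 i) //= lerDl sumr_ge0.
Qed.

(** The maximal Rayleigh quotient is itself an eigenvalue, hence at most [lamN A]. *)
Lemma lamN_lt0 (A : 'M[R]_N) : (0 < N)%N -> symmx A -> lamN A < 0 ->
  exists2 c, 0 < c & forall v, form A v <= - c * sqn v.
Proof.
move=> N0 sA l0; have [m em hm] := rayleigh_max N0 sA.
exists (- m); last by move=> v; rewrite opprK.
rewrite oppr_gt0; apply: le_lt_trans l0; apply: sup_upper_bound => //.
split; first by exists m.
have [e he] := eigs_bounded A; exists e => a /he; apply: le_trans; exact: ler_norm.
Qed.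

Lemma normRS_bounded (p : R * 'M[R]_N) :
  has_sup ([set `|p.1|] `|` [set `|a| | a in eigs p.2]).
Proof.
split; first by exists `|p.1|; left.
have [e he] := eigs_bounded p.2; exists (Num.max `|p.1| e) => _ [->|[a /he ? <-]].
  by rewrite le_max lexx.
by rewrite le_max orbC; apply/orP; left.
Qed.

Lemma normRS_fst (p : R * 'M[R]_N) : `|p.1| <= normRS p.
Proof. by apply: sup_upper_bound; [exact: normRS_bounded|left]. Qed.

(** Rayleigh maximization is applied to both [A] and [- A], giving the two signs. *)
Lemma normRS_form (p : R * 'M[R]_N) v : (0 < N)%N -> symmx p.2 ->
  `|form p.2 v| <= normRS p * sqn v.
Proof.
move=> N0 sA.
have hE a : eigs p.2 a -> `|a| <= normRS p.
  by move=> ea; apply: sup_upper_bound; [exact: normRS_bounded|right; exists a].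
have [m em hm] := rayleigh_max N0 sA.
have [m' em' hm'] := rayleigh_max N0 (symmxN sA).
have := hE _ em; have := hE _ (eigenvalueN em'); rewrite normrN => h1 h2.
have := hm v; have := hm' v; rewrite form_opp => g1 g2.
have s0 := sqn_ge0 v.
rewrite ler_norml; apply/andP; split.
  by rewrite lerNl (le_trans g1) // ler_wpM2r // (le_trans _ h1) // ler_norm.
by rewrite (le_trans g2) // ler_wpM2r // (le_trans _ h2) // ler_norm.
Qed.

End Extrema.

(** * Semiconvexity and the exponential barrier *)

Section LocalQuadraticity.
Context {R : realType} {N : nat}.
Hypothesis N_gt0 : (0 < N)%N.
Implicit Types (x y z d b : 'rV[R]_N) (A B H : 'M[R]_N).

Lemma ler_sqr_mono (s t : R) : 0 <= s -> s <= t -> s ^+ 2 <= t ^+ 2.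
Proof. by move=> s0 st; nra. Qed.

(** Convexity of [f + k * sqn], phrased by supporting paraboloids: sup-convolutions provide these
    directly, and no differentiability is involved. *)
Definition semiconvex (k : R) (f : 'rV[R]_N -> R) : Prop :=
  forall x, exists p, forall y, f x + dot p (y - x) - k * sqn (y - x) <= f y.

Definition touches (f : 'rV[R]_N -> R) x (r : R) b A : Prop :=
  forall d, sqn d <= r ^+ 2 -> f (x + d) <= f x + dot b d + form A d / 2.

(** Semiconvexity spreads negativity: a very negative value at [z] forces negative values on a whole
    ball whose radius depends only on [k] and [delta]. *)
Lemma semiconvex_neg_ball (k delta r : R) (psi : 'rV[R]_N -> R) z :
  0 < k -> 0 < delta -> 0 <= r -> r <= 1 / 4 -> 12 * k * r ^+ 2 <= delta ->
  semiconvex k psi -> (forall y, sqn y <= 1 -> psi y <= 0) ->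
  sqn z <= (1 / 4) ^+ 2 -> psi z < - delta ->
  forall y, sqn (y - z) <= r ^+ 2 -> psi y <= - delta / 2.
Proof.
move=> k0 d0 r0 r4 kr sc neg z4 psiz y yr.
have [p hp] := sc y.
(* Adding twice the bound at [z] to the bound at the opposite point cancels [p] and leaves
   [3 * psi y <= 2 * psi z + 6 * k * r ^+ 2]. The opposite point stays in the unit ball since
   [1/4 + 3 * (1/4) = 1]. *)
have h1 := hp z; have h2 := hp (y - 2%:R *: (z - y)).
have e2 : y - 2%:R *: (z - y) - y = - (2%:R *: (z - y)) by rewrite addrAC subrr add0r.
move: h2; rewrite e2 sqnN sqnZ !dotE.
have zy : sqn (z - y) <= r ^+ 2 by rewrite -sqnN opprB.
have v1 : sqn (y - 2%:R *: (z - y)) <= 1.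
  have -> : y - 2%:R *: (z - y) = z + 3%:R *: (y - z).
    by apply/rowP => i; rewrite !mxE; ring.
  have -> : 1 = (1 / 4 + 3 / 4 : R) ^+ 2 by field.
  apply: sqn_triangle => //; rewrite sqnZ.
  have : r ^+ 2 <= (1 / 4) ^+ 2 by apply: ler_sqr_mono; lra.
  by lra.
have := neg _ v1; move: h1; rewrite dotDr dotNr => h1 h3 h2.
by nra.
Qed.

(** Squaring [1 + t / 2 <= expR (t / 2)] gives a lower bound with a genuine quadratic term, as
    needed to read a Hessian off the barrier. *)
Lemma expR_ge_sqr (t : R) : -2 <= t -> (1 + t / 2) ^+ 2 <= expR t.
Proof.
move=> t2; have -> : expR t = expR (t / 2) ^+ 2.
  by rewrite expr2 -expRD; congr expR; field.
by apply: ler_sqr_mono; [lra|have := expR_ge1Dx (t / 2 : R); lra].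
Qed.

(* The barrier is eta * exp (- a |y - z|^2): outside the ball of radius r around z its
   Laplacian is positive, so adding it moves the maximum of psi to a point where psi is
   touched by a quadratic of negative trace. *)
Lemma barrier_step (k delta : R) : 0 < k -> 0 < delta ->
  exists eps tau : R, [/\ 0 < eps, 0 < tau, tau <= 1 / 2 &
  forall psi : 'rV[R]_N -> R, continuous psi -> semiconvex k psi ->
    psi 0 = 0 -> (forall y, sqn y <= 1 -> psi y <= 0) ->
    forall z, sqn z <= (1 / 4) ^+ 2 -> psi z < - delta ->
    exists x b H, [/\ sqn x <= (1 / 2) ^+ 2, symmx H, \tr H <= - eps &
      touches psi x tau b H]].
Proof.
move=> k0 d0; set n : R := N%:R.
have n0 : 0 < n by rewrite ltr0n.
set r := Num.min (1 / 4) (delta / (12 * k)).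
have kk : 0 < 12 * k by lra.
have dk : 0 < delta / (12 * k) by rewrite divr_gt0.
have r0 : 0 < r by rewrite lt_min dk andbT; lra.
have r4 : r <= 1 / 4 by rewrite ge_min lexx.
have rd : r <= delta / (12 * k) by rewrite ge_min lexx orbT.
have kr : 12 * k * r ^+ 2 <= delta.
  have : 12 * k * r <= delta by rewrite mulrC -ler_pdivlMr.
  have : 0 <= 12 * k * r by rewrite mulr_ge0 // ltW.
  by rewrite expr2 mulrA; nra.
have r20 : 0 < r ^+ 2 by rewrite exprn_gt0.
(* Outside the ball of radius [r] around [z] this gives [a * sqn c >= 4 * n], which beats the
   [5 / 2 * a * n] coming from the scalar part of the Hessian. *)
set a := 4 * n / r ^+ 2.
have a0 : 0 < a by rewrite divr_gt0 // mulr_gt0.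
have ar : a * r ^+ 2 = 4 * n by rewrite /a divfK // gt_eqF.
(* Below [delta / 2]: the perturbed function is negative on the ball around [z] but positive at [0],
   so its maximum lies outside that ball. *)
set eta := delta / 4; have eta0 : 0 < eta by rewrite /eta; lra.
set e0 := expR (- (a / 16)); have e00 : 0 < e0 by rewrite expR_gt0.
(* The bound [1 / 2] keeps [x + d] in the unit ball; the bound [a^-1] keeps the exponent in the
   range of [expR_ge_sqr]. *)
set tau := Num.min (1 / 2) a^-1.
have tau0 : 0 < tau by rewrite lt_min invr_gt0 a0 andbT; lra.
have tau2 : tau <= 1 / 2 by rewrite ge_min lexx.
have atau : a * tau <= 1.
  have : tau <= a^-1 by rewrite ge_min lexx orbT.
  by rewrite -(ler_pM2l a0) divff // gt_eqF.
exists (eta * e0 * (a * n)), tau; split => //.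
  exact: mulr_gt0 (mulr_gt0 eta0 e00) (mulr_gt0 a0 n0).
move=> psi cpsi sc psi0 neg z z4 psiz.
set E := fun y => expR (- a * sqn (y - z)).
have cE : continuous E.
  apply: continuous_fun_expR; apply: continuous_funM; first exact: continuous_funC.
  exact: continuous_sqnB.
have cW : continuous (fun y => psi y + eta * E y).
  apply: continuous_funD => //; apply: continuous_funM => //.
  exact: continuous_funC.
have [x x1 xmax] := max_on_eball 0 1 cW.
rewrite subr0 expr1n in x1.
have {}xmax y : sqn y <= 1 -> psi y + eta * E y <= psi x + eta * E x.
  by move=> y1; apply: xmax; rewrite subr0 expr1n.
have E1 y : E y <= 1.
  by rewrite -expR0 ler_expR mulNr oppr_le0 mulr_ge0 ?sqn_ge0 // ltW.
have Ep y : 0 < E y by exact: expR_gt0.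
have W0 : eta * E 0 <= psi x + eta * E x.
  by have := xmax 0; rewrite sqn0 psi0 add0r; apply.
have etaE0 : 0 < eta * E 0 by rewrite mulr_gt0.
have xr : r ^+ 2 < sqn (x - z).
  rewrite ltNge; apply/negP => xr.
  have := semiconvex_neg_ball k0 d0 (ltW r0) r4 kr sc neg z4 psiz xr.
  have := E1 x; rewrite -(ler_pM2l eta0) mulr1; rewrite /eta in W0 etaE0 *; lra.
have psix := neg _ x1.
(* As [psi x <= 0], maximality against the point [0] gives [E 0 <= E x]: the maximizer is at least
   as close to [z] as [0] is. *)
have xz : sqn (x - z) <= sqn z.
  have : E 0 <= E x by rewrite -(ler_pM2l eta0); lra.
  rewrite ler_expR ler_nM2l ?oppr_lt0 //.
  by rewrite sub0r sqnN.
have x2 : sqn x <= (1 / 2) ^+ 2.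
  have -> : 1 / 2 = 1 / 4 + 1 / 4 :> R by field.
  by rewrite -(subrK z x); apply: sqn_triangle => //; lra.
have ex : e0 <= E x.
  rewrite ler_expR mulNr lerN2 ler_pM2l //.
  by apply: le_trans xz _; apply: le_trans z4 _; lra.
set c := x - z in xr xz *; set e := E x in ex *.
(* The gradient of [- eta * E] at [x], and a relaxation of its Hessian
   [eta * e * (2 a I - 4 a^2 c^T c)] that leaves room for the error of the quadratic lower bound on
   the exponential. *)
exists x, ((eta * e * (2 * a)) *: c),
  ((eta * e) *: ((5 / 2 * a)%:M - (a ^+ 2) *: (c^T *m c))).
have ee : 0 < eta * e by rewrite mulr_gt0 // (lt_le_trans e00).
split => //.
- apply: symmxZ; apply: symmxD; first exact: symmx_scalar.
  by apply: symmxN; apply: symmxZ; exact: symmx_rank1.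
- rewrite mxtraceZ mxtraceD mxtrace_scalar_rV linearN /= mxtraceZ mxtrace_rank1 -/n.
  have ac : 4 * n <= a * sqn c by rewrite -ar ler_pM2l // ltW.
  have : n * (5 / 2 * a) - a ^+ 2 * sqn c <= - (a * n).
    have : a * (4 * n) <= a * (a * sqn c) by rewrite ler_pM2l.
    by rewrite expr2 -mulrA; have := mulr_gt0 a0 n0; lra.
  rewrite -(ler_pM2l ee) => h; apply: le_trans h _.
  rewrite mulrN lerN2; apply: ler_wpM2r; first by rewrite ltW // mulr_gt0.
  by rewrite ler_pM2l.
move=> d dtau; set be := dot c d; set q := sqn d.
have q0 : 0 <= q by exact: sqn_ge0.
have dxy : sqn (x + d) <= 1.
  have -> : 1 = (1 / 2 + 1 / 2 : R) ^+ 2 by field.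
  apply: sqn_triangle => //; try lra.
  by apply: le_trans dtau _; apply: ler_sqr_mono; lra.
have beb : `|be| <= 1 / 4 * tau.
  by apply: sqr_dot_le; [lra|exact: ltW|exact: le_trans xz z4|].
have := xmax _ dxy.
have -> : E (x + d) = e * expR (- (a * (2 * be + q))).
  rewrite /e /E -expRD; congr expR; rewrite -/c.
  have -> : x + d - z = c + d by rewrite addrAC.
  by rewrite sqnD -/be -/q; ring.
have aq : a * q <= 1.
  have : a * q <= a * tau ^+ 2 by rewrite ler_pM2l.
  by rewrite expr2 mulrA; nra.
have abe : a * `|be| <= 1 / 4.
  have : a * `|be| <= a * (1 / 4 * tau) by rewrite ler_pM2l.
  by lra.
have abe1 : a * be <= 1 / 4.
  by apply: le_trans abe; rewrite ler_pM2l // ler_norm.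
set X := expR _; rewrite -/e => hW.
have hX : (1 + - (a * (2 * be + q)) / 2) ^+ 2 <= X by apply: expR_ge_sqr; lra.
rewrite dotZl -/be form_scale form_add form_opp form_scale form_scalar form_rank1 -/be -/q.
have aq2 : (a * q) ^+ 2 <= a * q.
  have := mulr_ge0 (ltW a0) q0; rewrite expr2; nra.
have key : 1 - X <= 2 * a * be + (5 / 2 * a * q - a ^+ 2 * be ^+ 2) / 2.
  have := sqr_ge0 (a * be + a * q).
  by lra.
have : eta * e * (1 - X) <= eta * e * (2 * a * be + (5 / 2 * a * q - a ^+ 2 * be ^+ 2) / 2).
  by rewrite ler_pM2l.
by lra.
Qed.
End LocalQuadraticity.

(** * Approximation by quadratics through descent on the trace *)

Section QuadraticApproximation.
Context {R : realType} {N : nat}.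
Hypothesis N_gt0 : (0 < N)%N.
Implicit Types (x y z d b : 'rV[R]_N) (A B H : 'M[R]_N).

(** Divide by [t] and let [t] tend to [0]; an explicit small [t] replaces the limit. *)
Lemma le0_of_linear_le_quadratic (al c t0 : R) : 0 < t0 ->
  (forall t, 0 < t -> t <= t0 -> t * al <= t ^+ 2 * c) -> al <= 0.
Proof.
move=> t00 h; rewrite leNgt; apply/negP => al0.
set t := Num.min t0 (al / (`|c| + 1)).
have c1 : 0 < `|c| + 1 by rewrite ltr_wpDl.
have tp : 0 < t by rewrite lt_min t00 divr_gt0.
have tt : t <= t0 by rewrite ge_min lexx.
have ta : t * (`|c| + 1) <= al by rewrite -ler_pdivlMr // ge_min lexx orbT.
have := h _ tp tt; rewrite expr2 -mulrA ler_pM2l // => h1.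
have : t * c <= t * `|c| by rewrite ler_pM2l // ler_norm.
by lra.
Qed.

(* Averaging the two-sided bounds along d and -d cancels the linear terms. *)
Lemma touches_form_ge (k r : R) f x b A : 0 < r -> semiconvex k f ->
  touches f x r b A -> forall d, - (2 * k) * sqn d <= form A d.
Proof.
move=> r0 sc tch d.
have [->|d0] := eqVneq d 0; first by rewrite sqn0 /form mul0mx dot0l mulr0.
have [p hp] := sc x; have dp := sqn_gt0 d0.
set s := r / Num.sqrt (sqn d).
have sq0 : 0 < Num.sqrt (sqn d) by rewrite sqrtr_gt0.
have s0 : 0 < s by rewrite divr_gt0.
have sd : s ^+ 2 * sqn d = r ^+ 2.
  by rewrite /s expr_div_n sqr_sqrtr ?ltW // divfK // gt_eqF.
have sdr : sqn (s *: d) <= r ^+ 2 by rewrite sqnZ sd.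
have h1 := tch _ sdr; have h2 := tch (- (s *: d)); rewrite sqnN in h2.
have {}h2 := h2 sdr.
have := hp (x + s *: d); have := hp (x - s *: d).
rewrite !(addrC x) !addrK sqnN => g1 g2.
move: h1 h2; rewrite !(addrC x) form_oppv !formZ.
rewrite !sqnZ !dotE in g1 g2 * => h1 h2.
have : s ^+ 2 * (- (2 * k) * sqn d) <= s ^+ 2 * form A d by lra.
by rewrite ler_pM2l // exprn_gt0.
Qed.

(** [A + 2k I] is nonnegative by [touches_form_ge], so its form is controlled by its trace. A bound
    on the trace of [A] alone thus bounds [A] from above. *)
Lemma touches_form_le (k r : R) f x b A d : 0 < r -> 0 <= k -> semiconvex k f ->
  symmx A -> touches f x r b A ->
  form A d <= N%:R * (\tr A + N%:R * (2 * k)) * sqn d.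
Proof.
move=> r0 k0 sc sA tch.
have h := touches_form_ge r0 sc tch.
have sP : symmx (A + (2 * k)%:M) by apply: symmxD => //; exact: symmx_scalar.
have := @form_le_trace R N (A + (2 * k)%:M) d sP.
rewrite mxtraceD mxtrace_scalar_rV form_add form_scalar => g.
have : form A d + 2 * k * sqn d <= N%:R * (\tr A + N%:R * (2 * k)) * sqn d.
  by apply: g => x'; rewrite form_add form_scalar; have := h x'; lra.
have := mulr_ge0 k0 (sqn_ge0 d); lra.
Qed.

Lemma touches_trace_ge (k r : R) f x b A : 0 < r -> semiconvex k f ->
  touches f x r b A -> - (N%:R * (2 * k)) <= \tr A.
Proof. by move=> r0 sc tch; apply: mxtrace_ge; apply: touches_form_ge tch. Qed.

Lemma continuous_affine_comp (V : normedModType R) (f : V -> R) (x : V) (r : R) :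
  continuous f -> continuous (fun y : V => f (x + r *: y)).
Proof.
move=> cf y; apply: (@continuous_comp _ _ _ (fun y : V => x + r *: y) f); last exact: cf.
by apply: cvgD; [exact: cvg_cst|apply: cvgZr; exact: cvg_id].
Qed.

(** This is [barrier_step] after subtracting the touching quadratic and rescaling its ball to the
    unit ball. In the second alternative the Hessian found there is added to [A]. *)
Lemma trace_decrease (k T delta : R) : 0 < k -> 0 < delta ->
  exists eps tau : R, [/\ 0 < eps, 0 < tau, tau <= 1 / 2 &
  forall f, continuous f -> semiconvex k f ->
  forall x (r : R) b A, 0 < r -> symmx A -> \tr A <= T -> touches f x r b A ->
    (forall d, sqn d <= (r / 4) ^+ 2 ->
       f x + dot b d + form A d / 2 - delta * r ^+ 2 <= f (x + d)) \/
    exists x' b' A', [/\ sqn (x' - x) <= (r / 2) ^+ 2, symmx A',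
       \tr A' <= \tr A - eps & touches f x' (tau * r) b' A']].
Proof.
move=> k0 d0.
(* [L] bounds every admissible [A] from above, so the semiconvexity constant [k + L / 2] of the
   rescaled function, and hence [eps] and [tau], depend on [T] but not on [A] or [r]. *)
set L := N%:R * (`|T| + N%:R * (2 * k)).
have L0 : 0 <= L by rewrite mulr_ge0 // addr_ge0 // mulr_ge0 // mulr_ge0 // ltW.
have [|eps [tau [e0 t0 t2 step]]] := @barrier_step R N N_gt0 (k + L / 2) delta _ d0.
  by rewrite ltr_pwDl // divr_ge0.
exists eps, tau; split => // f cf sc x r b A r0 sA trA tch.
have r20 : 0 < r ^+ 2 by rewrite exprn_gt0.
have [h|] := pselect (forall d, sqn d <= (r / 4) ^+ 2 ->
       f x + dot b d + form A d / 2 - delta * r ^+ 2 <= f (x + d)); first by left.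
move/existsNP => [d /not_implyP[d4 /negP]]; rewrite -ltNge => hd; right.
pose psi := fun y => r ^- 2 * f (x + r *: y) +
   (- (r ^- 2 * f x) + (- (r^-1 * dot b y) + (- (2^-1 * form A y)))).
have psiE y : r ^+ 2 * psi y =
    f (x + r *: y) - f x - r * dot b y - r ^+ 2 * form A y / 2.
  by rewrite /psi; field; rewrite gt_eqF.
have cpsi : continuous psi.
  apply: continuous_funD.
    apply: continuous_funM; first exact: continuous_funC.
    exact: continuous_affine_comp.
  apply: continuous_funD; first exact: continuous_funC.
  apply: continuous_funD.
    apply: continuous_funN; apply: continuous_funM; first exact: continuous_funC.
    rewrite (_ : dot b = fun y => dot b (y - 0)); first exact: continuous_dotB.
    by apply/funext => y; rewrite subr0.
  apply: continuous_funN; apply: continuous_funM; first exact: continuous_funC.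
  exact: continuous_form.
have psi0 : psi 0 = 0.
  by rewrite /psi scaler0 addr0 dot0r /form dot0r !mulr0 !oppr0 !addr0 subrr.
clearbody psi.
have Lb e : form A e <= L * sqn e.
  apply: le_trans (touches_form_le e r0 (ltW k0) sc sA tch) _.
  apply: ler_wpM2r; first exact: sqn_ge0.
  by rewrite ler_wpM2l // lerD2r (le_trans trA) // ler_norm.
have scpsi : semiconvex (k + L / 2) psi.
  move=> y; have [p hp] := sc (x + r *: y).
  exists (r^-1 *: p - r^-1 *: b - y *m A) => w.
  have := hp (x + r *: w).
  have -> : x + r *: w - (x + r *: y) = r *: (w - y).
    by apply/rowP => i; rewrite !mxE; ring.
  set e := w - y; rewrite dotZr sqnZ => h.
  set P := dot _ e.
  have hP : r ^+ 2 * P = r * dot p e - r * dot b e - r ^+ 2 * dot (y *m A) e.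
    by rewrite /P !dotE; field; rewrite gt_eqF.
  have hy := psiE y; have hw := psiE w.
  have ew : w = y + e by rewrite addrC subrK.
  rewrite [in dot b w]ew [in form A w]ew formD // dotDr in hw.
  have := Lb e; rewrite -(ler_pM2l r20) => hL.
  by rewrite -(ler_pM2l r20); lra.
have neg y : sqn y <= 1 -> psi y <= 0.
  move=> y1; rewrite -(pmulr_rle0 _ r20) psiE.
  have := tch (r *: y); rewrite sqnZ ler_piMr ?(ltW r20) // => /(_ isT).
  by rewrite dotZr formZ; lra.
have [||x0 [b0 [H [x02 sH trH tH]]]] := step psi cpsi scpsi psi0 neg (r^-1 *: d).
- rewrite sqnZ exprVn mulrC ler_pdivrMr // -exprMn.
  by have -> : 1 / 4 * r = r / 4 by field.
- rewrite -(ltr_pM2l r20) psiE scalerA divff ?gt_eqF // scale1r dotZr formZ.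
  have -> : r * (r^-1 * dot b d) = dot b d by field; rewrite gt_eqF.
  have -> : r ^+ 2 * (r^-1 ^+ 2 * form A d) = form A d by field; rewrite gt_eqF.
  by lra.
exists (x + r *: x0), (b + r *: (x0 *m A) + r *: b0), (A + H); split.
- rewrite addrC addKr sqnZ.
  have -> : (r / 2) ^+ 2 = r ^+ 2 * (1 / 2) ^+ 2 by field.
  by rewrite ler_pM2l.
- exact: symmxD.
- by rewrite mxtraceD; lra.
move=> D Dr; have := tH (r^-1 *: D).
rewrite sqnZ exprVn mulrC ler_pdivrMr // -exprMn => /(_ Dr).
rewrite -(ler_pM2l r20) !mulrDr !psiE.
have -> : r *: (x0 + r^-1 *: D) = r *: x0 + D.
  by rewrite scalerDr scalerA divff ?gt_eqF // scale1r.
rewrite addrA formD // form_add !dotZr !formZ !dotE.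
have -> : r ^+ 2 * (r^-1 * dot b0 D) = r * dot b0 D by field; rewrite gt_eqF.
have -> : r ^+ 2 * (form A x0 + 2 * (r^-1 * dot (x0 *m A) D) + r^-1 ^+ 2 * form A D) / 2
  = r ^+ 2 * form A x0 / 2 + r * dot (x0 *m A) D + form A D / 2.
  by field; rewrite gt_eqF.
have -> : r ^+ 2 * (r^-1 ^+ 2 * form H D / 2) = form H D / 2 by field; rewrite gt_eqF.
have -> : r * (dot b x0 + r^-1 * dot b D) = r * dot b x0 + dot b D by field; rewrite gt_eqF.
by lra.
Qed.

(** [trace_decrease] is iterated. Each failure costs a factor [tau] in the radius and lowers the
    trace by [eps]; since traces are at least [- N * 2k], a fixed number [n] of rounds suffices and
    [theta] is [tau ^+ n]. *)
Lemma quadratic_approx (k T delta : R) : 0 < k -> 0 < delta ->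
  exists2 theta : R, 0 < theta &
  forall f, continuous f -> semiconvex k f ->
  forall x (r : R) b A, 0 < r -> symmx A -> \tr A <= T -> touches f x r b A ->
  exists x' r' b' A', [/\ theta * r <= r', r' <= r, sqn (x' - x) <= r ^+ 2 & symmx A'] /\
    touches f x' r' b' A' /\
    forall d, sqn d <= (r' / 4) ^+ 2 ->
      f x' + dot b' d + form A' d / 2 - delta * r' ^+ 2 <= f (x' + d).
Proof.
move=> k0 d0; have [eps [tau [e0 t0 t2 step]]] := trace_decrease T k0 d0.
have [n hn] : exists n : nat, T + N%:R * (2 * k) < n%:R * eps.
  exists (Num.truncn `|(T + N%:R * (2 * k)) / eps|).+1.
  rewrite -ltr_pdivrMr //; apply: le_lt_trans (ler_norm _) _.
  exact: truncnS_gt.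
exists (tau ^+ n); first by rewrite exprn_gt0.
move=> f cf sc x r b A r0 sA trA tch.
have {hn} : \tr A + N%:R * (2 * k) < n%:R * eps by lra.
have ht : tau ^+ n <= 1 by rewrite exprn_ile1 // ?ltW //; lra.
elim: n {ht} x r b A r0 sA trA tch => [|n IHn] x r b A r0 sA trA tch.
  by rewrite mul0r => h; have := touches_trace_ge r0 sc tch; lra.
rewrite -natr1 mulrDl mul1r => hn.
have taun : tau ^+ n.+1 <= 1 by rewrite exprn_ile1 // ?ltW //; lra.
have [h|[x1 [b1 [A1 [x1r sA1 trA1 tch1]]]]] := step _ cf sc x r b A r0 sA trA tch.
  exists x, r, b, A; split; last by [].
  by split => //; [rewrite ler_piMl // ltW|rewrite subrr sqn0 sqr_ge0].
have [|||x' [r' [b' [A' [[h1 h2 h3 h4] h5]]]]] := IHn x1 (tau * r) b1 A1 _ sA1 _ tch1.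
- by rewrite mulr_gt0.
- by lra.
- by lra.
(* The centre first moves by at most [r / 2] and later by at most [tau * r <= r / 2], so it never
   leaves the original ball. *)
have tr2 : tau * r <= r / 2 by have := ler_wpM2r (ltW r0) t2; lra.
exists x', r', b', A'; split => //; split => //.
- by rewrite exprSr -mulrA.
- by lra.
have -> : r ^+ 2 = (r / 2 + r / 2) ^+ 2 by field.
have -> : x' - x = (x' - x1) + (x1 - x) by rewrite addrA subrK.
apply: sqn_triangle => //; try by rewrite divr_ge0 // ltW.
by apply: le_trans h3 _; apply: ler_sqr_mono => //; rewrite ltW // mulr_gt0.
Qed.

End QuadraticApproximation.

(** * Porous sets and a counting argument on cubes *)

Section Porosity.
Context {R : realType} {N : nat}.
Hypothesis N_gt0 : (0 < N)%N.
Implicit Types (x y z d b P : 'rV[R]_N).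

Definition cube (a : 'rV[R]_N) (s : R) : set 'rV[R]_N :=
  [set x | forall i, a ord0 i <= x ord0 i <= a ord0 i + s].

Definition subcorner (a : 'rV[R]_N) (s : R) (M : nat) (t : {ffun 'I_N -> 'I_M}) :
  'rV[R]_N := \row_i (a ord0 i + s / M%:R * (t i)%:R).

Lemma segment_split (M : nat) (h y : R) : (0 < M)%N -> 0 <= y -> y <= h * M%:R ->
  exists j : 'I_M, h * j%:R <= y <= h * j%:R + h.
Proof.
case: M => // M _; elim: M => [|M IHM] y0 yM.
  by exists ord0; rewrite mulr0 add0r y0 /=; lra.
have [yM'|yM'] := leP y (h * M.+1%:R).
  have [j hj] := IHM y0 yM'.
  by exists (widen_ord (leqnSn _) j).
exists ord_max => /=; rewrite (ltW yM') /=; apply: le_trans yM _.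
by rewrite -(natr1 M.+1) mulrDr mulr1.
Qed.

Lemma cube_split a (s : R) (M : nat) x : (0 < M)%N -> cube a s x ->
  exists t : {ffun 'I_N -> 'I_M}, cube (subcorner a s t) (s / M%:R) x.
Proof.
move=> M0 ax.
have h i : exists j : 'I_M,
    s / M%:R * j%:R <= x ord0 i - a ord0 i <= s / M%:R * j%:R + s / M%:R.
  have /andP[h1 h2] := ax i; apply: segment_split => //; first by lra.
  by rewrite divfK ?pnatr_eq0 ?gtn_eqF //; lra.
exists [ffun i => projT1 (cid (h i))] => i; rewrite mxE ffunE.
by case: cid => j /= hj; lra.
Qed.

(** At each scale the cell that misses [K] is discarded and the remaining [M ^ N - 1] cells are
    covered recursively. *)
Lemma porous_cover (K : set 'rV[R]_N) (M : nat) (s1 : R) : (0 < M)%N ->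
  (forall a (s : R), 0 < s -> s <= s1 -> exists t : {ffun 'I_N -> 'I_M},
     forall x, K x -> ~ cube (subcorner a s t) (s / M%:R) x) ->
  forall j a (s : R), 0 < s -> s <= s1 -> exists L : seq 'rV[R]_N,
    (size L <= (M ^ N).-1 ^ j)%N /\
    forall x, K x -> cube a s x -> exists2 c, c \in L & cube c (s / M%:R ^+ j) x.
Proof.
move=> M0 hK; elim=> [|j IHj] a s s0 ss1.
  exists [:: a]; split => [|x Kx ax]; first by rewrite expn0.
  by exists a; rewrite ?inE // expr0 divr1.
have M1 : 1 <= M%:R :> R by rewrite ler1n.
have sM0 : 0 < s / M%:R by rewrite divr_gt0 // ltr0n.
have sM1 : s / M%:R <= s1.
  by apply: le_trans ss1; rewrite ler_pdivrMr ?ltr0n // ler_peMr // ltW.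
have [t0 ht0] := hK a s s0 ss1.
have h (t : {ffun 'I_N -> 'I_M}) := cid (IHj (subcorner a s t) _ sM0 sM1).
pose L := flatten [seq projT1 (h t) | t <- enum (predC1 t0)].
exists L; split.
  rewrite /L size_flatten /shape -map_comp sumnE big_map.
  apply: (@leq_trans (\sum_(t <- enum (predC1 t0)) (M ^ N).-1 ^ j)).
    by apply: leq_sum => t _ /=; case: (projT2 (h t)).
  rewrite big_const_seq count_predT iter_addn_0 -cardE cardC1 card_ffun !card_ord.
  by rewrite mulnC -expnS.
move=> x Kx /(cube_split M0)[t xt].
have tt0 : t != t0 by apply/eqP => e; apply: (ht0 _ Kx); rewrite -e.
have [_ /(_ x Kx xt)[c cL xc]] := projT2 (h t).
exists c.
  apply/flattenP; exists (projT1 (h t)) => //.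
  by apply/mapP; exists t => //; rewrite mem_enum inE.
by rewrite exprS invfM mulrA.
Qed.

(** Bernoulli's inequality for [(1 + 1/c) ^ i], cleared of denominators. *)
Lemma bernoulli_nat (c i : nat) : (c ^ i * (c + i) <= c.+1 ^ i * c)%N.
Proof.
elim: i => [|i IHi]; first by rewrite !expn0 addn0.
rewrite !expnS; have := leq_mul (leqnn c.+1) IHi; nia.
Qed.

Lemma expn_dominates (c C : nat) : (0 < c)%N ->
  exists i, (C * c ^ i < c.+1 ^ i)%N.
Proof.
move=> c0; exists (C * c)%N; have := bernoulli_nat c (C * c).
have : (0 < c ^ (C * c))%N by rewrite expn_gt0 c0.
set p := (c ^ _)%N; set q := (_ ^ _)%N => p0 h.
have : (p * (C + 1) <= q)%N by nia.
by nia.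
Qed.

(* Slopes vary by at most [C] times the distance of their contact points, so if the
   contact points were porous there would be too few cubes to carry a fine grid of
   slopes. *)
Lemma full_cube (K : 'rV[R]_N -> 'rV[R]_N -> Prop) (a0 : 'rV[R]_N) (s0 s1 s C : R) :
  0 < s0 -> 0 < s1 -> 0 < s ->
  (forall P, (forall i, 0 <= P ord0 i <= s) -> exists2 x, K x P & cube a0 s0 x) ->
  (forall x x' P P' (t : R), 0 < t -> t <= s1 -> K x P -> K x' P' ->
     (forall i, `|x ord0 i - x' ord0 i| <= t) ->
     forall i, `|P ord0 i - P' ord0 i| <= C * t) ->
  forall M : nat, (1 < M)%N -> forall s2 : R, 0 < s2 ->
  exists a (l : R), [/\ 0 < l, l <= s2 & forall t : {ffun 'I_N -> 'I_M},
    exists x P, K x P /\ cube (subcorner a l t) (l / M%:R) x].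
Proof.
move=> s00 s10 sp slopes lip M M1 s2 s20; apply: contrapT => nofull.
have M0 : (0 < M)%N by exact: ltnW.
set sm := Num.min s1 s2.
have sm0 : 0 < sm by rewrite lt_min s10.
pose KK := [set x | exists P, K x P].
have porous a (l : R) : 0 < l -> l <= sm -> exists t : {ffun 'I_N -> 'I_M},
     forall x, KK x -> ~ cube (subcorner a l t) (l / M%:R) x.
  move=> l0 lm; apply: contrapT => h; apply: nofull; exists a, l; split => //.
    by rewrite (le_trans lm) // ge_min lexx orbT.
  move=> t; apply: contrapT => h'; apply: h; exists t => x [P KxP] xc.
  by apply: h'; exists x, P.
pose m0 := (Num.truncn (s0 / sm)).+1.
have m00 : 0 < m0%:R :> R by rewrite ltr0n.
set s3 := s0 / m0%:R.
have s30 : 0 < s3 by rewrite divr_gt0.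
have s3m : s3 <= sm.
  rewrite ler_pdivrMr // mulrC -ler_pdivrMr //; apply: ltW; exact: truncnS_gt.
have cov := porous_cover M0 porous.
set c := (M ^ N).-1.
have c1 : c.+1 = (M ^ N)%N by rewrite prednK // expn_gt0 M0.
have c0 : (0 < c)%N.
  by rewrite -ltnS c1; apply: leq_trans M1 _; rewrite -[X in (X <= _)%N]expn1 leq_pexp2l.
(* After [i0] extra subdivisions, [C] times the side of a covering cube is below the spacing
   [s / M ^ i] of the slope grid, whatever [i] is. *)
have [i0 hi0] : exists i0, C * s3 < s * M%:R ^+ i0.
  exists (Num.truncn `|C * s3 / s|).+1.
  rewrite [ltRHS]mulrC -ltr_pdivrMr //; apply: le_lt_trans (ler_norm _) _.
  apply: lt_trans (truncnS_gt _) _; rewrite -natrX ltr_nat.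
  exact: ltn_expl.
(* For this [i] the [M ^ (N * i)] grid slopes outnumber the at most [m0 ^ N * c ^ (i0 + i)] covering
   cubes. *)
have [i hi] := expn_dominates (m0 ^ N * c ^ i0) c0.
have h (t : {ffun 'I_N -> 'I_m0}) := cid (cov (i0 + i)%N (subcorner a0 s0 t) s3 s30 s3m).
pose L := flatten [seq projT1 (h t) | t <- enum {ffun 'I_N -> 'I_m0}].
have sL : (size L <= m0 ^ N * c ^ (i0 + i))%N.
  rewrite /L size_flatten /shape -map_comp sumnE big_map.
  apply: (@leq_trans (\sum_(t <- enum {ffun 'I_N -> 'I_m0}) c ^ (i0 + i))).
    by apply: leq_sum => t _ /=; case: (projT2 (h t)).
  by rewrite big_const_seq count_predT iter_addn_0 -cardE card_ffun !card_ord mulnC.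
pose n := (M ^ i)%N.
have n0 : 0 < n%:R :> R by rewrite ltr0n expn_gt0 M0.
pose slope (g : {ffun 'I_N -> 'I_n}) : 'rV[R]_N := \row_k (s / n%:R * (g k)%:R).
have hg g : exists c' x, [/\ c' \in L, K x (slope g) & cube c' (s3 / M%:R ^+ (i0 + i)) x].
  have [|x Kx x0] := slopes (slope g).
    move=> k; rewrite mxE; apply/andP; split.
      by rewrite mulr_ge0 // divr_ge0 // ltW.
    by rewrite mulrAC ler_pdivrMr // ler_pM2l // ler_nat ltnW.
  have [t xt] := cube_split (ltn0Sn _ : (0 < m0)%N) x0.
  have [_ /(_ x _ xt)[|c' c'L xc]] := projT2 (h t); first by exists (slope g).
  exists c', x; split => //.
  apply/flattenP; exists (projT1 (h t)) => //.
  by apply/mapP; exists t => //; rewrite mem_enum.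
pose cc g := projT1 (cid (hg g)).
have ccL g : cc g \in L by rewrite /cc; case: cid => c' /= [x []].
(* Pigeonhole: an injective assignment of cubes to slopes contradicts the count, and two slopes
   sharing a cube contradict the Lipschitz bound. *)
have [inj|] := pselect (injective cc).
  have : (size [seq cc g | g <- enum {ffun 'I_N -> 'I_n}] <= size L)%N.
    apply: uniq_leq_size; first by rewrite map_inj_uniq ?enum_uniq.
    by move=> ? /mapP[g _ ->].
  rewrite size_map -cardE card_ffun !card_ord => hn.
  have := leq_trans hn sL; rewrite leqNgt => /negP; apply.
  by rewrite /n -expnM (mulnC i) expnM -c1 expnD mulnA.
apply => g g' egg'; apply/ffunP => k; apply/val_inj; apply: contrapT => gk.
move: egg'; rewrite /cc; case: cid => c1' /= [x [_ Kx xc]].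
case: cid => c2' /= [x' [_ Kx' xc']] e; subst c2'.
set t := s3 / M%:R ^+ (i0 + i) in xc xc'.
have Mi : 0 < M%:R ^+ (i0 + i) :> R by rewrite exprn_gt0 // ltr0n.
have t0 : 0 < t by rewrite divr_gt0.
have ts1 : t <= s1.
  apply: (@le_trans _ _ s3); last by rewrite (le_trans s3m) // ge_min lexx.
  rewrite ler_pdivrMr //; apply: ler_peMr; first exact: ltW.
  by rewrite exprn_ege1 // ler1n.
have hx l : `|x ord0 l - x' ord0 l| <= t.
  by have := xc l; have := xc' l; rewrite ler_norml; lra.
have := lip _ _ _ _ t t0 ts1 Kx Kx' hx k; apply/negP.
rewrite -ltNge !mxE -mulrBr normrM gtr0_norm ?divr_gt0 //.
have : C * t < s / n%:R.
  rewrite /t /n natrX exprD ltr_pdivlMr ?exprn_gt0 ?ltr0n //.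
  have -> : C * (s3 / (M%:R ^+ i0 * M%:R ^+ i)) * M%:R ^+ i = C * s3 / M%:R ^+ i0.
    by field; rewrite !expf_neq0 ?pnatr_eq0 ?gtn_eqF.
  by rewrite ltr_pdivrMr // exprn_gt0 // ltr0n.
move=> h1; apply: lt_le_trans h1 _; apply: ler_peMr; first by rewrite divr_ge0 ?ltW.
case: (ltngtP (g k) (g' k)) => [uv|uv|//].
  by rewrite distrC -natrB ?(ltnW uv) // normr_nat ler1n subn_gt0.
by rewrite -natrB ?(ltnW uv) // normr_nat ler1n subn_gt0.
Qed.

End Porosity.

(** * Contact points of a semiconvex sum with affine functions *)

Section ContactSet.
Context {R : realType} {N : nat}.
Implicit Types (x y z d b P : 'rV[R]_N) (A B : 'M[R]_N).

Definition box x0 (r : R) : set 'rV[R]_N :=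
  [set y | forall i, `|y ord0 i - x0 ord0 i| <= r].

Lemma compact_box x0 r : compact (box x0 r).
Proof.
have c : compact [set v : 'rV[R]_N |
    forall i, `[x0 ord0 i - r, x0 ord0 i + r]%classic (v ord0 i)].
  apply: (@rV_compact _ _ (fun i => `[x0 ord0 i - r, x0 ord0 i + r]%classic)) => i.
  exact: segment_compact.
rewrite (_ : box x0 r = [set v : 'rV[R]_N |
    forall i, `[x0 ord0 i - r, x0 ord0 i + r]%classic (v ord0 i)]) //.
by apply/seteqP; split => v h i; have := h i; rewrite /= in_itv /= ler_distl.
Qed.

Lemma box_center x0 (r : R) : 0 <= r -> box x0 r x0.
Proof. by move=> r0 i; rewrite subrr normr0. Qed.

Lemma box_add x0 (r s : R) x d : box x0 r x -> (forall i, `|d ord0 i| <= s) ->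
  box x0 (r + s) (x + d).
Proof.
move=> h1 h2 i; rewrite mxE addrAC; apply: le_trans (ler_normD _ _) _.
exact: lerD (h1 i) (h2 i).
Qed.

Lemma box_le x0 (r s : R) x : r <= s -> box x0 r x -> box x0 s x.
Proof. by move=> rs h i; apply: le_trans (h i) rs. Qed.

Lemma coord_le_sqn d (a : R) i : 0 <= a -> sqn d <= a ^+ 2 -> `|d ord0 i| <= a.
Proof. by move=> a0 h; apply: le_trans (normr_coord d i) (norm_le_sqn a0 h). Qed.

Lemma sqn_le_coord d (a : R) : (forall i, `|d ord0 i| <= a) ->
  sqn d <= N%:R * a ^+ 2.
Proof.
move=> h; rewrite /sqn /dot -[X in X%:R]card_ord mulr_natl -sumr_const.
apply: ler_sum => i _; rewrite -expr2 -real_normK ?num_real //.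
exact: ler_sqr_mono.
Qed.

Lemma dot_le_coord b d (s a : R) : 0 <= s -> (forall i, `|b ord0 i| <= s) ->
  (forall i, `|d ord0 i| <= a) -> `|dot b d| <= N%:R * (s * a).
Proof.
move=> s0 hb hd; apply: le_trans (ler_norm_sum _ _ _) _.
rewrite -[X in X%:R]card_ord mulr_natl -sumr_const.
by apply: ler_sum => i _; rewrite normrM ler_pM.
Qed.

(** The contact point lies in the small box while the majorization holds on the box five times as
    large, so that points displaced by a few [rho] can still be tested. *)
Definition contact (f g : 'rV[R]_N -> R) x0 (rho : R) x P : Prop :=
  box x0 rho x /\
  forall y, box x0 (5 * rho) y -> f y + g y <= f x + g x + dot P (y - x).

(** Maximize [f + g] minus the linear function of slope [P] on the large box. The drop [kappa] away
    from the centre outweighs the linear term, which forces the maximizer into the small box. *)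
Lemma contact_exists (f g : 'rV[R]_N -> R) x0 (rho r kappa s : R) P :
  continuous f -> continuous g -> 0 < rho -> 0 < kappa -> r <= f x0 + g x0 ->
  (forall y, box x0 (5 * rho) y ->
    (exists i, rho <= `|y ord0 i - x0 ord0 i|) -> f y + g y <= r - kappa) ->
  0 < s -> 5 * rho * N%:R * s < kappa ->
  (forall i, `|P ord0 i| <= s) -> exists x, contact f g x0 rho x P.
Proof.
move=> cf cg rho_gt0 kappa_gt0 w_center w_boundary s0 sk Ps.
have r5 : 0 <= 5 * rho by rewrite mulr_ge0 // ltW.
have cw : continuous (fun y => f y + (g y + - dot P (y - x0))).
  apply: continuous_funD => //; apply: continuous_funD => //.
  by apply: continuous_funN; exact: continuous_dotB.
have [|x] := EVT_max_rV _ (@compact_box x0 (5 * rho)) (continuous_subspaceT cw).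
  by exists x0; exact: box_center.
rewrite inE => xb xmax.
have {}xmax y : box x0 (5 * rho) y ->
    f y + g y - dot P (y - x0) <= f x + g x - dot P (x - x0).
  by move=> yb; have := xmax y; rewrite inE => /(_ yb); lra.
exists x; split => [i|y yb]; last first.
  have := xmax y yb; have -> : y - x = (y - x0) - (x - x0) by rewrite opprB addrA subrK.
  by rewrite !(dotDr, dotNr); lra.
rewrite leNgt; apply/negP => xi.
have := w_boundary x xb; move/(_ (ex_intro _ i (ltW xi))) => h.
have {}h2 := xmax x0; rewrite subrr dot0r in h2.
have {}h2 : f x0 + g x0 - 0 <= f x + g x - dot P (x - x0).
  by apply: h2; exact: box_center.
have := @dot_le_coord P (x - x0) s (5 * rho) (ltW s0) Ps.
have hx j : `|(x - x0) ord0 j| <= 5 * rho by rewrite !mxE; exact: xb.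
move=> /(_ hx); rewrite ler_norml => /andP[h3 _].
by lra.
Qed.

(* At a contact point the subgradients of f and g add up to the slope, hence f is
   squeezed between two paraboloids with the same tangent. *)
Lemma contact_sandwich (f g : 'rV[R]_N -> R) (k : R) x0 (rho : R) x P :
  semiconvex k f -> semiconvex k g -> 0 < rho -> contact f g x0 rho x P ->
  (exists p, forall y, box x0 (5 * rho) y ->
     f y <= f x + dot p (y - x) + k * sqn (y - x)) /\
  (forall y, f x + g x + dot P (y - x) - 2 * k * sqn (y - x) <= f y + g y).
Proof.
move=> scf scg rho_gt0 [xb hP]; have [p hp] := scf x; have [q hq] := scg x.
have e : p + q - P = 0.
  set Q := p + q - P; apply: sqn_eq0; apply/eqP; rewrite eq_le sqn_ge0 andbT.
  have t0 : 0 < rho / (`|Q| + 1) by rewrite divr_gt0 // ltr_wpDl.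
  apply: (le0_of_linear_le_quadratic t0 (c := 2 * k * sqn Q)) => t tp tt.
  have yb : box x0 (5 * rho) (x + t *: Q).
    apply: (@box_le _ (rho + rho)); first by lra.
    apply: box_add => // i; rewrite mxE normrM gtr0_norm //.
    apply: (@le_trans _ _ (t * (`|Q| + 1))).
      by rewrite ler_pM2l // (le_trans (normr_coord _ _)) // lerDl.
    by rewrite -ler_pdivlMr // ltr_wpDl.
  have := hP _ yb; have := hp (x + t *: Q); have := hq (x + t *: Q).
  rewrite !(addrC x) !addrK sqnZ !dotZr.
  have -> : sqn Q = dot p Q + dot q Q - dot P Q by rewrite {1}/sqn {1}/Q !dotE.
  by lra.
have {}e v : dot P v = dot p v + dot q v.
  by apply/eqP; rewrite eq_sym -subr_eq0 -dotDl -dotNl -dotDl e dot0l.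
split.
  exists p => y yb; have := hP _ yb; have := hq y; rewrite e; lra.
by move=> y; have := hp y; have := hq y; rewrite e; lra.
Qed.

(** At [x' + e *: evec R i] with [|e| = t], compare the affine majorant from [x] with the paraboloid
    minorant from [x']; the minorant from [x] relates the values at [x] and [x']. Both signs of [e]
    are used. *)
Lemma contact_lipschitz (f g : 'rV[R]_N -> R) (k : R) x0 (rho : R) x x' P P' (t : R) :
  0 < k -> semiconvex k f -> semiconvex k g -> 0 < rho -> 0 < t -> t <= rho ->
  contact f g x0 rho x P -> contact f g x0 rho x' P' ->
  (forall i, `|x ord0 i - x' ord0 i| <= t) ->
  forall i, `|P ord0 i - P' ord0 i| <= 2 * k * (N%:R + 1) * t.
Proof.
move=> k_gt0 scf scg rho_gt0 t0 tr hx hx' xx i.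
have [_ low] := contact_sandwich scf scg rho_gt0 hx.
have [_ low'] := contact_sandwich scf scg rho_gt0 hx'.
have [xb up] := hx; have [x'b up'] := hx'.
have sd : sqn (x' - x) <= N%:R * t ^+ 2.
  by apply: sqn_le_coord => j; rewrite !mxE distrC.
have key (e : R) : `|e| = t -> e * (P' ord0 i - P ord0 i) <= 2 * k * (N%:R + 1) * t ^+ 2.
  move=> et; have ee : e ^+ 2 = t ^+ 2 by rewrite -et real_normK ?num_real.
  have yb : box x0 (5 * rho) (x' + e *: evec R i).
    apply: (@box_le _ (rho + rho)); first by lra.
    apply: box_add => // j; rewrite !mxE eqxx /= normrM et.
    apply: le_trans tr; apply: ler_piMr; first exact: ltW.
    by rewrite normr_nat lern1; case: eqP.
  have := up _ yb; have := low' (x' + e *: evec R i); have := low x'.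
  have -> : x' + e *: evec R i - x = (x' - x) + e *: evec R i by rewrite addrAC.
  rewrite (addrC x' (e *: _)) addrK sqnZ sqn_evec !dotDr !dotZr !dot_evec ee.
  by have : 2 * k * sqn (x' - x) <= 2 * k * (N%:R * t ^+ 2); [rewrite ler_pM2l //; lra|lra].
have k1 := key t (gtr0_norm t0); have k2 := key (- t).
rewrite normrN in k2; have {}k2 := k2 (gtr0_norm t0).
rewrite -(ler_pM2l t0) -[X in X * `|_|]gtr0_norm // -normrM ler_norml.
by apply/andP; split; lra.
Qed.

End ContactSet.

(** * Almost opposite touching quadratics for two semiconvex functions *)

Section SemiconvexSum.
Context {R : realType} {N : nat}.
Hypothesis N_gt0 : (0 < N)%N.
Implicit Types (x y z d b P : 'rV[R]_N) (A B : 'M[R]_N).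

(* If f is within delta r^2 of a quadratic of Hessian A on a ball centred near a contact
   point, then g is at most the tangent plane minus that quadratic, up to delta r^2; a
   further paraboloid localizes the touching point. *)
Lemma touch_complement (f g : 'rV[R]_N -> R) x0 (rho delta r : R) x b A z P :
  continuous g -> 0 < delta -> 0 < r -> r <= rho -> symmx A -> box x0 (2 * rho) x ->
  touches f x r b A ->
  (forall d, sqn d <= (r / 4) ^+ 2 ->
     f x + dot b d + form A d / 2 - delta * r ^+ 2 <= f (x + d)) ->
  contact f g x0 rho z P -> sqn (z - x) <= (r / 16) ^+ 2 ->
  exists x2 b2, sqn (x2 - x) <= (r / 8) ^+ 2 /\
    touches g x2 (r / 8) b2 (- A + (256 * delta)%:M).
Proof.
move=> cg d0 r0 rr sA xb tch low [zb up] zx.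
(* [G] is [g] minus its expected majorant and minus the paraboloid [128 * delta * sqn (y - x)]. That
   paraboloid costs only [delta * r ^+ 2 / 2] at [z], and confines the maximizer to radius [r / 8],
   half of the ball on which [f] is controlled. *)
set G := fun y => g y + (dot b (y - x) + (2^-1 * form A (y - x) +
   (- (128 * delta * sqn (y - x)) + - dot P (y - z)))).
have cG : continuous G.
  apply: continuous_funD => //; apply: continuous_funD; first exact: continuous_dotB.
  apply: continuous_funD.
    by apply: continuous_funM; [exact: continuous_funC|exact: continuous_formB].
  apply: continuous_funD.
    apply: continuous_funN; apply: continuous_funM; first exact: continuous_funC.
    exact: continuous_sqnB.
  by apply: continuous_funN; exact: continuous_dotB.
have [x2 x2b x2max] := max_on_eball x (r / 4) cG.
have r20 : 0 < r ^+ 2 by rewrite exprn_gt0.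
have zx4 : sqn (z - x) <= (r / 4) ^+ 2.
  by apply: le_trans zx _; apply: ler_sqr_mono; lra.
have Gz : f z + g z - f x - 128 * delta * (r / 16) ^+ 2 <= G z.
  have := tch (z - x); rewrite (addrC x) subrK => h.
  have {}h : f z <= f x + dot b (z - x) + form A (z - x) / 2.
    by apply: h; apply: le_trans zx _; apply: ler_sqr_mono; lra.
  rewrite /G subrr dot0r.
  have : 128 * delta * sqn (z - x) <= 128 * delta * (r / 16) ^+ 2.
    by rewrite ler_pM2l // mulr_gt0.
  by lra.
have yb d : sqn d <= (r / 4) ^+ 2 -> box x0 (5 * rho) (x + d).
  move=> dr; apply: (@box_le _ _ _ (2 * rho + rho)); first by lra.
  apply: box_add => // i; apply: coord_le_sqn; first by lra.
  by apply: le_trans dr _; apply: ler_sqr_mono; lra.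
have x2e : x + (x2 - x) = x2 by rewrite addrC subrK.
have Gx2 : G x2 <= f z + g z - f x + delta * r ^+ 2 - 128 * delta * sqn (x2 - x).
  have := low _ x2b; have := up _ (yb _ x2b); rewrite x2e /G; lra.
have x28 : sqn (x2 - x) <= (r / 8) ^+ 2.
  have := x2max z zx4 => h.
  have : 128 * delta * sqn (x2 - x) <= 128 * delta * (r / 8) ^+ 2.
    have -> : (r / 8) ^+ 2 = r ^+ 2 / 64 by field.
    have e : (r / 16) ^+ 2 = r ^+ 2 / 256 by field.
    by rewrite e in Gz; have := mulr_gt0 d0 r20; lra.
  by rewrite ler_pM2l // mulr_gt0.
set e := x2 - x in x28 x2e Gx2 *.
exists x2, (P - b - e *m A + (256 * delta) *: e); split => // d d8.
have dxr : sqn (x2 + d - x) <= (r / 4) ^+ 2.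
  have -> : x2 + d - x = e + d by rewrite addrAC.
  have -> : r / 4 = r / 8 + r / 8 by field.
  by apply: sqn_triangle => //; lra.
have := x2max _ dxr; rewrite /G -/e.
have -> : x2 + d - x = e + d by rewrite addrAC.
have -> : x2 + d - z = (x2 - z) + d by rewrite addrAC.
by rewrite form_add form_opp form_scalar formD // sqnD !dotE; lra.
Qed.

(** Three errors of at most [eps / 8] each: the slope between [x0] and [z], the slope between [z]
    and [x], and the curvature term between [z] and [x]. *)
Lemma contact_value_ge (f g : 'rV[R]_N -> R) (k : R) x0 (rho r s eps l : R) x z P :
  0 < k -> semiconvex k f -> semiconvex k g -> 0 < rho -> r <= f x0 + g x0 ->
  contact f g x0 rho z P -> 0 <= s -> (forall i, `|P ord0 i| <= s) ->
  8 * rho * N%:R * s <= eps -> 0 < l -> l <= rho -> 16 * k * N%:R * rho * l <= eps ->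
  (forall i, `|(z - x) ord0 i| <= rho) -> sqn (z - x) <= l ^+ 2 ->
  r - 3 * eps / 8 <= f x + g x.
Proof.
move=> k0 scf scg rho0 wc zc s0 Ps s2 l0 lrho le zx zxs.
have [_ low] := contact_sandwich scf scg rho0 zc.
have [zb up] := zc; set n : R := N%:R in s2 le *.
have n1 : 1 <= n by rewrite ler1n.
have e1 : r - eps / 8 <= f z + g z.
  have := up x0 (box_center x0 _); move/(_ (mulr_ge0 (ler0n _ 5) (ltW rho0))) => h1.
  have zb' i : `|(x0 - z) ord0 i| <= rho by rewrite !mxE distrC; exact: zb.
  have := dot_le_coord s0 Ps zb'; rewrite ler_norml -/n => /andP[_ h2].
  by lra.
have := low x; have xz i : `|(x - z) ord0 i| <= rho.
  by have := zx i; rewrite -normrN !mxE opprB.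
have := dot_le_coord s0 Ps xz; rewrite ler_norml -/n => /andP[h2 _].
have sx : sqn (x - z) <= l ^+ 2 by rewrite -sqnN opprB.
have : 2 * k * sqn (x - z) <= eps / 8.
  have h3 : 2 * k * sqn (x - z) <= 2 * k * l ^+ 2 by rewrite ler_pM2l // mulr_gt0.
  apply: le_trans h3 _.
  have kl : 0 < 2 * k * l by rewrite !mulr_gt0.
  have h4 : 2 * k * l * l <= 2 * k * l * rho by rewrite ler_pM2l.
  have h5 : 2 * k * l * rho <= 2 * k * l * rho * n by rewrite ler_peMr // mulr_ge0 // ltW.
  by rewrite expr2; lra.
by lra.
Qed.

Lemma double_bounds (m : nat) : (1 < 2 * (m + 4))%N /\ (m + 4 < 2 * (m + 4))%N.
Proof. by split; lia. Qed.

(** The order of choices matters. [theta] comes first, then [M] from [theta], then a cube all of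
    whose cells meet the contact set. Whatever ball [quadratic_approx] returns inside that cube, its
    radius is large compared with a cell, so a contact point lies near its centre. *)
Lemma touch_sum (f g : 'rV[R]_N -> R) (k : R) x0 (rho r kappa delta eps : R) :
  continuous f -> continuous g -> 0 < k -> semiconvex k f -> semiconvex k g ->
  0 < rho -> 0 < kappa -> r <= f x0 + g x0 ->
  (forall y, box x0 (5 * rho) y ->
    (exists i, rho <= `|y ord0 i - x0 ord0 i|) -> f y + g y <= r - kappa) ->
  (forall eta, 0 < eta -> exists2 h, 0 < h & forall x y,
     box x0 (5 * rho) x -> box x0 (5 * rho) y -> sqn (x - y) <= h ^+ 2 ->
     g x - g y <= eta) ->
  0 < delta -> 0 < eps ->
  exists x1 r1 b1 A x2 r2 b2 B,
    [/\ box x0 (3 * rho) x1, 0 < r1, symmx A & touches f x1 r1 b1 A] /\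
    [/\ box x0 (3 * rho) x2, 0 < r2, symmx B & touches g x2 r2 b2 B] /\
    (forall d, form A d + form B d <= delta * sqn d) /\
    r - eps <= f x1 + g x2.
Proof.
move=> cf cg k0 scf scg rho0 kappa0 wc wb ug delta0 eps0.
set n : R := N%:R; have n0 : 0 < n by rewrite ltr0n.
have d10 : 0 < delta / 256 by rewrite divr_gt0.
have b35 : 3 * rho <= 5 * rho by lra.
have b25 : 2 * rho <= 5 * rho by lra.
have b23 : 2 * rho <= 3 * rho by lra.
have b11 : rho + rho <= 5 * rho by lra.
have b21 : 2 * rho + rho <= 3 * rho by lra.
(* [n * (2 * k)] is the trace of the first touching Hessian, [2k I], supplied by [contact_sandwich].
   The factor 256 anticipates the one produced by [touch_complement]. *)
have [theta th0 approx] := @quadratic_approx R N N_gt0 k (n * (2 * k)) _ k0 d10.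
have [h h0 hug] := ug (eps / 8) (divr_gt0 eps0 (ltr0n _ 8)).
set s := Num.min (kappa / (6 * rho * n)) (eps / (8 * rho * n)).
have q1 : 0 < 6 * rho * n by rewrite !mulr_gt0.
have q2 : 0 < 8 * rho * n by rewrite !mulr_gt0.
have s0 : 0 < s by rewrite lt_min !divr_gt0.
have s1 : 6 * rho * n * s <= kappa by rewrite mulrC -ler_pdivlMr // ge_min lexx.
have s2 : 8 * rho * n * s <= eps by rewrite mulrC -ler_pdivlMr // ge_min lexx orbT.
have sk : 5 * rho * n * s < kappa.
  apply: lt_le_trans s1; rewrite ltr_pM2r // ltr_pM2r // ltr_pM2r //.
  by rewrite ltr_nat.
set lm := Num.min rho (Num.min h (eps / (16 * k * n * rho))).
have q3 : 0 < 16 * k * n * rho by rewrite !mulr_gt0.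
have lm0 : 0 < lm by rewrite !lt_min rho0 h0 divr_gt0.
(* With [r' >= theta * l / 8] this ensures [n * (l / M) <= r' / 16], the closeness that
   [touch_complement] asks of the contact point. *)
have [m hm] : exists m : nat, n * 64 < theta * m%:R.
  exists (Num.truncn (n * 64 / theta)).+1.
  by rewrite [ltRHS]mulrC -ltr_pdivrMr //; exact: truncnS_gt.
pose M := (2 * (m + 4))%N.
have [M1 mM] := double_bounds m; rewrite -/M in M1 mM.
have M0 : 0 < M%:R :> R by rewrite ltr0n ltnW.
have MR : M%:R = 2 * m%:R + 8 :> R by rewrite /M natrM natrD; clear; lra.
have M1R : 1 <= M%:R :> R by rewrite ler1n ltnW.
have m0 : 0 <= m%:R :> R by [].
have slopes P : (forall i, 0 <= P ord0 i <= s) ->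
    exists2 x, contact f g x0 rho x P /\ (forall i, `|P ord0 i| <= s) &
      cube (x0 - const_mx rho) (2 * rho) x.
  move=> hP; have hP' i : `|P ord0 i| <= s.
    by have /andP[p0 ps] := hP i; rewrite ger0_norm.
  have [x xc] := contact_exists cf cg rho0 kappa0 wc wb s0 sk hP'.
  exists x => // i; rewrite !mxE; have := xc.1 i; rewrite ler_distl; lra.
have lip x x' P P' (t : R) : 0 < t -> t <= rho ->
    contact f g x0 rho x P /\ (forall i, `|P ord0 i| <= s) ->
    contact f g x0 rho x' P' /\ (forall i, `|P' ord0 i| <= s) ->
    (forall i, `|x ord0 i - x' ord0 i| <= t) ->
    forall i, `|P ord0 i - P' ord0 i| <= 2 * k * (n + 1) * t.
  move=> t0 tr [hx _] [hx' _]; exact: contact_lipschitz k0 scf scg rho0 t0 tr hx hx'.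
have rho20 : 0 < 2 * rho by rewrite mulr_gt0.
have [a [l [l0 llm full]]] := full_cube N_gt0 rho20 rho0 s0 slopes lip M1 lm0.
have lrho : l <= rho by rewrite (le_trans llm) // ge_min lexx.
have lh : l <= h by rewrite (le_trans llm) // !ge_min lexx orbT.
have le : 16 * k * n * rho * l <= eps.
  by rewrite mulrC -ler_pdivlMr // (le_trans llm) // !ge_min lexx !orbT.
(* Every digit of this cell is [m + 4], half of [M], and [M >= 8]; hence [k1] lies between [l / 2]
   and [5 * l / 8] in each coordinate, and points within [l / 8] of it remain in the full cube. *)
have [k1 [P1 [[k1c _] k1cube]]] := full [ffun => Ordinal mM].
have [[p hp] _] := contact_sandwich scf scg rho0 k1c.
have k1a i : a ord0 i + l / 2 <= k1 ord0 i <= a ord0 i + l * (5 / 8).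
  have := k1cube i; rewrite !mxE ffunE /= natrD.
  have -> : l / M%:R * (m%:R + 4) = l / 2 by rewrite MR; field; clear -m0; lra.
  have : l / M%:R <= l / 8 by rewrite ler_pM2l // lef_pV2 ?posrE //; clear -MR m0; lra.
  by clear; lra.
have l80 : 0 < l / 8 by rewrite divr_gt0.
have l8rho : l / 8 <= rho by clear -l0 lrho; lra.
have tch0 : touches f k1 (l / 8) p (2 * k)%:M.
  move=> d dl; rewrite form_scalar.
  have := hp (k1 + d); rewrite (addrC k1) addrK => h1.
  have : f (d + k1) <= f k1 + dot p d + k * sqn d.
    apply: h1; rewrite addrC; apply: box_le b11 _.
    apply: box_add; first exact: k1c.1.
    by move=> i; apply: (@le_trans _ _ (l / 8)); [apply: coord_le_sqn => //; exact: ltW|exact: l8rho].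
  by lra.
have tr0 : \tr ((2 * k)%:M : 'M[R]_N) <= n * (2 * k) by rewrite mxtrace_scalar_rV.
have [x [r' [b [A [[r1 r2 xk sA] [tch low]]]]]] :=
  approx f cf scf k1 (l / 8) p _ l80 (symmx_scalar _) tr0 tch0.
have r'0 : 0 < r' by apply: lt_le_trans r1; rewrite mulr_gt0.
have xk' i : `|(x - k1) ord0 i| <= l / 8 by apply: coord_le_sqn => //; exact: ltW.
have r'8 : r' / 8 <= l by clear -r2 l0 r'0; lra.
have r'16 : r' / 16 <= l by clear -r2 l0 r'0; lra.
have r'80 : 0 <= r' / 8 by rewrite divr_ge0 // ltW.
have r'160 : 0 <= r' / 16 by rewrite divr_ge0 // ltW.
have xcube : cube a l x.
  by move=> i; move: (xk' i) (k1a i); rewrite !mxE ler_norml; clear -l0; lra.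
have [t xt] := cube_split (ltnW M1) xcube.
have [z [P [[zc Ps] zt]]] := full t.
have lM0 : 0 < l / M%:R by rewrite divr_gt0.
have zx i : `|(z - x) ord0 i| <= l / M%:R.
  by move: (xt i) (zt i); rewrite !mxE ler_norml; clear; lra.
have nlM : n * (l / M%:R) <= r' / 16.
  rewrite mulrA ler_pdivrMr //.
  have : theta * (l / 8) * M%:R <= r' * M%:R by rewrite ler_pM2r.
  have := ltr_pM2l l0; rewrite MR => hl.
  have : l * (n * 64) < l * (theta * m%:R) by rewrite hl.
  by move: (mulr_gt0 th0 l0); clear; lra.
have n1 : 1 <= n by rewrite ler1n.
have zxs : sqn (z - x) <= (r' / 16) ^+ 2.
  apply: le_trans (sqn_le_coord zx) _.
  apply: (@le_trans _ _ ((n * (l / M%:R)) ^+ 2)).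
    have -> : (n * (l / M%:R)) ^+ 2 = n * (n * (l / M%:R) ^+ 2) by ring.
    by rewrite -/n ler_pM2l // ler_peMl // sqr_ge0.
  by apply: ler_sqr_mono => //; rewrite mulr_ge0 // ltW.
have xb : box x0 (2 * rho) x.
  by move=> i; move: (k1c.1 i) (xk' i) l8rho; rewrite !mxE ler_norml ler_distl ler_distl; clear; lra.
have r'rho : r' <= rho by exact: le_trans r2 l8rho.
have [x2 [b2 [x2x tch2]]] := touch_complement cg d10 r'0 r'rho sA xb tch low zc zxs.
have x2b : box x0 (3 * rho) x2.
  have -> : x2 = x + (x2 - x) by rewrite addrC subrK.
  apply: box_le b21 _; apply: box_add => // i.
  by apply: (@le_trans _ _ (r' / 8)); [exact: coord_le_sqn|exact: le_trans r'8 lrho].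
exists x, r', b, A, x2, (r' / 8), b2, (- A + (256 * (delta / 256))%:M).
split; first by split => //; exact: box_le xb.
split.
  split => //; first by rewrite divr_gt0.
  by apply: symmxD; [exact: symmxN|exact: symmx_scalar].
split.
  by move=> d; rewrite form_add form_opp form_scalar; clear; lra.
have e1 := contact_value_ge k0 scf scg rho0 wc zc (ltW s0) Ps s2 l0 lrho le.
have {}e1 : r - 3 * eps / 8 <= f x + g x.
  apply: e1; last by apply: le_trans zxs _; exact: ler_sqr_mono.
  move=> i; apply: le_trans (zx i) _; apply: le_trans lrho.
  by rewrite ler_pdivrMr // ler_peMr // ltW.
have e3 : g x - g x2 <= eps / 8.
  apply: hug.
  - exact: box_le xb.
  - exact: box_le x2b.
  - rewrite -sqnN opprB; apply: le_trans x2x _; apply: ler_sqr_mono => //.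
    exact: le_trans r'8 lh.
by clear -e1 e3 eps0; lra.
Qed.

End SemiconvexSum.

(** * Upper semicontinuous maxima and sup-convolution *)

Section SupConvolution.
Context {R : realType} {N : nat}.

Lemma ereal_lt_real (X Y : \bar R) : (X < Y)%E ->
  exists a : R, (X < a%:E)%E /\ (a%:E <= Y)%E.
Proof.
case: X => [x| |]; case: Y => [y| |] //=.
- by move=> xy; exists y.
- by move=> _; exists (x + 1); rewrite lte_fin ltrDl ltr01 leey.
- by move=> _; exists y; rewrite ltNyr.
- by move=> _; exists 0; rewrite ltNyr leey.
Qed.

Lemma ereal_lt_dense (X : \bar R) (b : R) : (X < b%:E)%E ->
  exists a : R, (X < a%:E)%E /\ a < b.
Proof.
case: X => [x| |] //=; last by move=> _; exists (b - 1); rewrite ltNyr; split => //; lra.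
by rewrite lte_fin => xb; exists ((x + b) / 2); rewrite lte_fin; split; lra.
Qed.

(* The superlevel sets of G generate a filter, to which near-covering is applied. *)
Lemma usc_attains_max (T : topologicalType) (D : set T) (G : T -> \bar R) :
  compact D -> D !=set0 ->
  (forall x, D x -> forall a : R, (G x < a%:E)%E ->
     \forall y \near x, D y -> (G y < a%:E)%E) ->
  exists2 z, D z & forall y, D y -> (G y <= G z)%E.
Proof.
move=> cD [d0 Dd0] uG; apply: contrapT => nomax.
have above z : D z -> exists2 i, D i & (G z < G i)%E.
  move=> Dz; apply: contrapT => h; apply: nomax; exists z => // y Dy.
  by rewrite leNgt; apply/negP => zy; apply: h; exists y.
pose F : set_system T := [set A | exists2 a, D a & forall z, D z -> (G a <= G z)%E -> A z].
have FF : Filter F.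
  split; first by exists d0.
    move=> A B [a Da hA] [b Db hB].
    have [ab|/ltW ba] := leP (G a) (G b).
      exists b => // z Dz bz; split; last exact: hB.
      by apply: hA => //; exact: le_trans bz.
    exists a => // z Dz az; split; first exact: hA.
    by apply: hB => //; exact: le_trans az.
  by move=> A B AB [a Da hA]; exists a => // z Dz az; apply: AB; exact: hA.
have := proj2 (near_covering_withinP D) (proj1 (compact_near_coveringP D) cD).
move/(_ T F (fun i z => (G z < G i)%E) FF) => [x Dx|a Da hF].
  have [i Di xi] := above x Dx.
  have [c [xc ci]] := ereal_lt_real xi.
  exists ([set y | D y -> (G y < c%:E)%E], [set j | (c%:E <= G j)%E]).
    split; first exact: uG.
    by exists i => // z Dz iz; exact: le_trans ci iz.
  by move=> [y j] /= [h1 h2] Dy; apply: lt_le_trans (h1 Dy) h2.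
by have := hF a Da (lexx _) a Da; rewrite ltxx.
Qed.

Lemma usc_on_add_continuous (D : set 'rV[R]_N) (u : 'rV[R]_N -> \bar R)
    (h : 'rV[R]_N -> R) :
  usc_on D u -> continuous h -> usc_on D (fun z => (u z + (h z)%:E)%E).
Proof.
move=> [unoo uu] ch; split => [x Dx|x Dx a].
  by have := unoo x Dx; case: (u x).
rewrite -lteBrDr // -EFinB => /ereal_lt_dense[c [uc ca]].
have hc : \forall y \near x, h y < a - c.
  have : h x < a - c by lra.
  move=> hx; have := ch x; move/cvgrPdist_lt/(_ (a - c - h x)).
  rewrite subr_gt0 => /(_ hx); apply: filterS => y.
  by rewrite ltr_norml; lra.
have := uu x Dx c uc; move: hc; apply: filterS2 => y hy uy Dy.
rewrite -lteBrDr // -EFinB; apply: lt_trans (uy Dy) _.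
by rewrite lte_fin; lra.
Qed.

(** The maximum is attained by compactness. It is real because [u] is never [+oo] on [D] and is
    finite at [x0], even if [u] takes the value [-oo] elsewhere. *)
Lemma sup_convolution (D : set 'rV[R]_N) (u : 'rV[R]_N -> \bar R) x0 (a0 k : R) :
  compact D -> usc_on D u -> D x0 -> u x0 = a0%:E ->
  exists f : 'rV[R]_N -> R,
    (forall x, exists z a, [/\ D z, u z = a%:E & f x = a - k * sqn (z - x)]) /\
    (forall x z, D z -> (u z <= (f x + k * sqn (z - x))%:E)%E).
Proof.
move=> cD uu Dx0 ux0.
have h x : exists c : R, (exists z a, [/\ D z, u z = a%:E & c = a - k * sqn (z - x)]) /\
    forall z, D z -> (u z <= (c + k * sqn (z - x))%:E)%E.
  have ch : continuous (fun z : 'rV[R]_N => - (k * sqn (z - x))).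
    apply: continuous_funN; apply: continuous_funM; first exact: continuous_funC.
    exact: continuous_sqnB.
  have [noo uG] := usc_on_add_continuous uu ch.
  have [|z Dz zmax] := usc_attains_max cD _ uG; first by exists x0.
  have := uu.1 z Dz; case uz : (u z) => [a| |] // _; last first.
    by have := zmax x0 Dx0; rewrite uz ux0.
  exists (a - k * sqn (z - x)); split; first by exists z, a.
  move=> y Dy; have := zmax y Dy; rewrite uz -EFinD.
  by rewrite -leeBrDr // -EFinB opprK.
exists (fun x => projT1 (cid (h x))); split => x; case: cid => c /= [] //.
Qed.

End SupConvolution.

(** * Regularity and translation properties of sup-convolutions *)

Section SupConvolutionProperties.
Context {R : realType} {N : nat}.
Implicit Types (x y z d b c : 'rV[R]_N) (A B : 'M[R]_N) (u v : 'rV[R]_N -> \bar R).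

Definition is_supconv (D : set 'rV[R]_N) u (k : R) (f : 'rV[R]_N -> R) : Prop :=
  (forall x, exists z a, [/\ D z, u z = a%:E & f x = a - k * sqn (z - x)]) /\
  (forall x z, D z -> (u z <= (f x + k * sqn (z - x))%:E)%E).

(** The maximizer [z] for [x] is used as a competitor at [y], and the square is expanded. *)
Lemma supconv_subgradient D u (k : R) f x z (a : R) : is_supconv D u k f ->
  D z -> u z = a%:E -> f x = a - k * sqn (z - x) ->
  forall y, f x + dot ((2 * k) *: (z - x)) (y - x) - k * sqn (y - x) <= f y.
Proof.
move=> [_ S2] Dz uz fx y; have := S2 y z Dz; rewrite uz lee_fin.
have -> : z - y = (z - x) - (y - x) by rewrite opprB addrA subrK.
by rewrite sqnB fx dotZl; lra.
Qed.

Lemma supconv_semiconvex D u (k : R) f : is_supconv D u k f -> semiconvex k f.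
Proof.
move=> sc x; have [z [a [Dz uz fx]]] := sc.1 x.
by exists ((2 * k) *: (z - x)); exact: supconv_subgradient sc Dz uz fx.
Qed.

(** The subgradient [2k (z - x)] has length at most [2k (rD + r)], since [z] and [x] lie in balls
    about [c]. *)
Lemma supconv_diff_le D u (k : R) f c (rD r t : R) x y : is_supconv D u k f ->
  0 <= k -> 0 <= rD -> 0 <= r -> 0 <= t -> (forall z, D z -> sqn (z - c) <= rD ^+ 2) ->
  sqn (x - c) <= r ^+ 2 -> sqn (y - x) <= t ^+ 2 ->
  f x - f y <= 2 * k * (rD + r) * t + k * t ^+ 2.
Proof.
move=> sc k0 rD0 r0 t0 hD xr yt; have [z [a [Dz uz fx]]] := sc.1 x.
have := supconv_subgradient sc Dz uz fx y; rewrite dotZl => h.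
have zx : sqn (z - x) <= (rD + r) ^+ 2.
  have -> : z - x = (z - c) + (c - x) by rewrite addrA subrK.
  by apply: sqn_triangle => //; [exact: hD|rewrite -sqnN opprB].
have := sqr_dot_le (addr_ge0 rD0 r0) t0 zx yt; rewrite ler_norml => /andP[h1 _].
have h2 : 2 * k * (- ((rD + r) * t)) <= 2 * k * dot (z - x) (y - x).
  by rewrite ler_wpM2l // mulr_ge0.
have h3 : k * sqn (y - x) <= k * t ^+ 2 by rewrite ler_wpM2l.
by lra.
Qed.

Lemma small_step (C k e : R) : 0 <= C -> 0 <= k -> 0 < e ->
  exists t : R, [/\ 0 < t, t <= 1 & C * t + k * t ^+ 2 < e].
Proof.
move=> C0 k0 e0; set q := C + k + 1; have q0 : 0 < q by rewrite /q; lra.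
exists (Num.min 1 (e / q)); have t0 : 0 < Num.min 1 (e / q).
  by rewrite lt_min ltr01 divr_gt0.
have t1 : Num.min 1 (e / q) <= 1 by rewrite ge_min lexx.
have tq : Num.min 1 (e / q) * q <= e by rewrite -ler_pdivlMr // ge_min lexx orbT.
split => //; move: (Num.min _ _) t0 t1 tq => t t0 t1 tq.
have : k * t ^+ 2 <= k * t by rewrite ler_wpM2l // expr2 ler_piMr // ltW.
by rewrite /q in tq; lra.
Qed.

Lemma continuous_dist (T : topologicalType) (f : T -> R) :
  (forall (x : T) (e : R), 0 < e -> \forall y \near x, `|f x - f y| < e) -> continuous f.
Proof. by move=> h x; apply/cvgrPdist_lt => e; exact: h. Qed.

Lemma supconv_continuous D u (k : R) f c (rD : R) : is_supconv D u k f ->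
  0 <= k -> 0 <= rD -> (forall z, D z -> sqn (z - c) <= rD ^+ 2) -> continuous f.
Proof.
move=> sc k0 rD0 hD; apply: continuous_dist => x e e0.
set r := 1 + sqn (x - c); have s0 := sqn_ge0 (x - c).
have r0 : 0 <= r by rewrite addr_ge0.
have xr : sqn (x - c) <= r ^+ 2 by rewrite /r; nra.
have C0 : 0 <= 2 * k * (rD + (r + 1)) by rewrite !mulr_ge0 // !addr_ge0.
have [t [t0 t1 te]] := small_step C0 k0 e0.
move: (near_sqn x t0); apply: filterS => y yt.
have yr : sqn (y - c) <= (r + 1) ^+ 2.
  have -> : y - c = (x - c) + (y - x) by rewrite [RHS]addrC addrA subrK.
  apply: sqn_triangle => //; apply: le_trans yt _.
  by rewrite expr1n expr_le1 // ltW.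
have xr1 : sqn (x - c) <= (r + 1) ^+ 2.
  by apply: le_trans xr _; apply: ler_sqr_mono => //; rewrite lerDl.
have xy : sqn (x - y) <= t ^+ 2 by rewrite -sqnN opprB.
have h1 := supconv_diff_le sc k0 rD0 (addr_ge0 r0 ler01) (ltW t0) hD xr1 yt.
have h2 := supconv_diff_le sc k0 rD0 (addr_ge0 r0 ler01) (ltW t0) hD yr xy.
by rewrite ltr_norml; lra.
Qed.

(** Translation principle: [z + d] is a competitor at [x + d] with the same penalty as [z] at [x],
    so a quadratic touching [f] at [x] moves to one touching [u] at [z] with the same gradient and
    Hessian. *)
Lemma supconv_touch D u (k : R) f x z (a r : R) b A : is_supconv D u k f ->
  D z -> u z = a%:E -> f x = a - k * sqn (z - x) -> touches f x r b A ->
  forall d, sqn d <= r ^+ 2 -> D (z + d) ->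
    (u (z + d)%R <= (a + dot b d + form A d / 2)%:E)%E.
Proof.
move=> [_ S2] Dz uz fx tch d dr Dzd; apply: le_trans (S2 (x + d) _ Dzd) _.
have -> : z + d - (x + d) = z - x by rewrite opprD addrACA subrr addr0.
by rewrite lee_fin; have := tch _ dr; rewrite fx; lra.
Qed.

Lemma usc_bounded_above (D : set 'rV[R]_N) u x0 (a0 : R) : compact D -> usc_on D u ->
  D x0 -> u x0 = a0%:E -> exists M : R, forall z (a : R), D z -> u z = a%:E -> a <= M.
Proof.
move=> cD uu Dx0 ux0; have [|z Dz zmax] := usc_attains_max cD _ uu.2; first by exists x0.
have := uu.1 z Dz; case uz : (u z) => [M| |] // _; last first.
  by have := zmax _ Dx0; rewrite uz ux0.
by exists M => y a Dy uy; have := zmax y Dy; rewrite uy uz lee_fin.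
Qed.

(** Turns a bound on a sum into separate strict bounds, to which semicontinuity applies. If one term
    is [-oo], its bound can be taken as low as the other requires. *)
Lemma usc_split u v z (q e : R) : 0 < e -> u z != +oo%E -> v z != +oo%E ->
  (forall a b : R, u z = a%:E -> v z = b%:E -> a + b <= q - e) ->
  exists a b : R, [/\ (u z < a%:E)%E, (v z < b%:E)%E & a + b <= q].
Proof.
move=> e0; case: (u z) => [a| |] //; case: (v z) => [b| |] // _ _ h.
- exists (a + e / 2), (b + e / 2); rewrite !lte_fin; have := h a b erefl erefl.
  by split; lra.
- by exists (a + 1), (q - (a + 1)); rewrite lte_fin ltNyr; split => //; lra.
- by exists (q - (b + 1)), (b + 1); rewrite lte_fin ltNyr; split => //; lra.
- by exists q, 0; rewrite !ltNyr addr0.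
Qed.

(** A bound on the diagonal persists near it, with loss [e]. Semicontinuity gives this locally, and
    near-covering of the compact [D'] makes the distance [t] uniform. *)
Lemma usc_sum_near_diagonal (D D' : set 'rV[R]_N) u v (q e : R) :
  compact D' -> D' `<=` D -> usc_on D u -> usc_on D v -> 0 < e ->
  (forall z (a b : R), D' z -> u z = a%:E -> v z = b%:E -> a + b <= q - e) ->
  exists2 t : R, 0 < t & forall z z' (a b : R), D' z -> D z' -> sqn (z' - z) <= t ^+ 2 ->
    u z = a%:E -> v z' = b%:E -> a + b <= q.
Proof.
move=> cD' sD uu uv e0 hq.
pose Q (t : R) z := forall z' (a b : R), D z' -> sqn (z' - z) <= t ^+ 2 ->
    u z = a%:E -> v z' = b%:E -> a + b <= q.
have := proj2 (near_covering_withinP D') (proj1 (compact_near_coveringP D') cD').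
move/(_ R (at_right 0) Q _) => near_t.
suff [t [t0 ht]] : exists t : R, 0 < t /\ D' `<=` Q t.
  by exists t => // z z' a b Dz Dz' zz; apply: (ht z Dz).
have : \forall t \near (0 : R)^'+, 0 < t /\ D' `<=` Q t.
  apply: filterI; first exact: nbhs_right_gt.
  apply: near_t => z D'z; have Dz := sD _ D'z.
  have [a [b [ua vb ab]]] := usc_split e0 (uu.1 z Dz) (uv.1 z Dz) (fun a (b : R) => hq z a b D'z).
  have /nbhs_ballP[r1 /= r10 h1] := uu.2 z Dz a ua.
  have /nbhs_ballP[r2 /= r20 h2] := uv.2 z Dz b vb.
  set r := Num.min r1 (r2 / 2).
  have r0 : 0 < r by rewrite lt_min r10 divr_gt0.
  exists (ball z r, [set t | 0 < t /\ t < r2 / 2]).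
    split => /=; first by apply/nbhs_ballP; exists r.
    apply: filterI; first exact: nbhs_right_gt.
    by apply: nbhs_right_lt; rewrite divr_gt0.
  move=> [y t] /= [yr [t0 tr]] D'y y' a' b' Dy' y't uy vy'.
  have : (u y < a%:E)%E.
    apply: h1; last exact: sD.
    by apply: le_ball yr; rewrite ge_min lexx.
  have : (v y' < b%:E)%E.
    apply: h2 => //; rewrite (splitr r2); apply: (@ball_triangle _ _ y).
      by apply: le_ball yr; rewrite ge_min lexx orbT.
    rewrite -ball_normE /=; apply: le_lt_trans tr.
    by apply: norm_le_sqn; [exact: ltW|rewrite -sqnN opprB].
  by rewrite uy vy' !lte_fin; lra.
by move/filter_ex.
Qed.

End SupConvolutionProperties.

(** * From semiconvex to upper semicontinuous functions *)

Section SumOfUsc.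
Context {R : realType} {N : nat}.
Hypothesis N_gt0 : (0 < N)%N.
Implicit Types (x y z d b c : 'rV[R]_N) (A B : 'M[R]_N) (u v : 'rV[R]_N -> \bar R).

Lemma ltr_sqr_mono (s t : R) : 0 <= s -> s < t -> s ^+ 2 < t ^+ 2.
Proof. by move=> s0 st; nra. Qed.

Lemma sqn_ge_of_far x y z (s t : R) : 0 <= s -> 0 <= t ->
  (s + t) ^+ 2 < sqn (y - x) -> sqn (z - y) <= s ^+ 2 -> t ^+ 2 <= sqn (z - x).
Proof.
move=> s0 t0 far zy; rewrite leNgt; apply/negP => /ltW zx.
have : sqn (y - x) <= (s + t) ^+ 2.
  have -> : y - x = (y - z) + (z - x) by rewrite addrA subrK.
  by apply: sqn_triangle => //; rewrite -sqnN opprB.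
by rewrite leNgt far.
Qed.

(* For large [k] the sup-convolutions almost diagonalize, so their sum inherits the
   strict maximum of [u + v] at [x0]. *)
Lemma supconv_sum_far (D : set 'rV[R]_N) u v x0 (a0 b0 c rho : R) :
  compact D -> D x0 -> usc_on D u -> usc_on D v -> u x0 = a0%:E -> v x0 = b0%:E ->
  0 < c -> 0 < rho ->
  (forall z (a b : R), D z -> u z = a%:E -> v z = b%:E ->
     a + b <= a0 + b0 - c * sqn (z - x0)) ->
  exists k0 kappa : R, 0 < kappa /\ forall k f g, k0 <= k -> 0 < k ->
    is_supconv D u k f -> is_supconv D v k g ->
    forall y, rho ^+ 2 <= sqn (y - x0) -> f y + g y <= a0 + b0 - kappa.
Proof.
move=> cD Dx0 uu uv ux0 vx0 c0 rho0 hmax.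
have [Mu hMu] := usc_bounded_above cD uu Dx0 ux0.
have [Mv hMv] := usc_bounded_above cD uv Dx0 vx0.
set D' := D `&` [set z | (rho / 2) ^+ 2 <= sqn (z - x0)].
have cD' : compact D'.
  apply: (subclosed_compact _ cD); last by move=> z [].
  apply: closedI; first by apply: compact_closed => //; exact: norm_hausdorff.
  have /continuous_closedP := @continuous_sqnB R N x0.
  by move/(_ [set t | (rho / 2) ^+ 2 <= t]); apply; exact: closed_ge.
(* Half of the drop of the maximum at distance [rho / 2]; the other half is the loss allowed in
   [usc_sum_near_diagonal]. *)
set kappa := c * (rho / 2) ^+ 2 / 2.
have kap0 : 0 < kappa by rewrite divr_gt0 // mulr_gt0 // exprn_gt0 // divr_gt0.
have hD' z (a b : R) : D' z -> u z = a%:E -> v z = b%:E ->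
    a + b <= a0 + b0 - kappa - kappa.
  move=> [Dz rz] uz vz; have := hmax z a b Dz uz vz.
  have : c * (rho / 2) ^+ 2 <= c * sqn (z - x0) by rewrite ler_pM2l.
  by rewrite /kappa; lra.
have sD' : D' `<=` D by move=> z [].
have [t t0 ht] := usc_sum_near_diagonal cD' sD' uu uv kap0 hD'.
set s := Num.min (t / 2) (rho / 4).
have s0 : 0 < s by rewrite lt_min !divr_gt0.
have st : s <= t / 2 by rewrite ge_min lexx.
have sr : s <= rho / 4 by rewrite ge_min lexx orbT.
have s20 : 0 < s ^+ 2 by rewrite exprn_gt0.
(* If the claim fails at [y], both penalties are at most [C]; with [k >= C / s ^+ 2] both maximizers
   are then within [s] of [y]. *)
set C := Mu + Mv - a0 - b0 + kappa.
exists (C / s ^+ 2), kappa; split => // k f g kC k0 scf scg y ry.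
rewrite leNgt; apply/negP => far.
have [z1 [a [Dz1 uz1 fy]]] := scf.1 y; have [z2 [b [Dz2 vz2 gy]]] := scg.1 y.
have ks : C <= k * s ^+ 2 by rewrite -ler_pdivrMr.
have aM := hMu _ _ Dz1 uz1; have bM := hMv _ _ Dz2 vz2.
have k1 : 0 <= k * sqn (z1 - y) by rewrite mulr_ge0 ?sqn_ge0 // ltW.
have k2 : 0 <= k * sqn (z2 - y) by rewrite mulr_ge0 ?sqn_ge0 // ltW.
rewrite fy gy in far.
have z1s : sqn (z1 - y) <= s ^+ 2.
  by rewrite -(ler_pM2l k0); apply: le_trans ks; rewrite /C; lra.
have z2s : sqn (z2 - y) <= s ^+ 2.
  by rewrite -(ler_pM2l k0); apply: le_trans ks; rewrite /C; lra.
have D'z1 : D' z1.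
  split => //; apply: (sqn_ge_of_far (ltW s0) _ _ z1s); first by rewrite divr_ge0 // ltW.
  by apply: lt_le_trans ry; apply: ltr_sqr_mono; lra.
have z12 : sqn (z2 - z1) <= t ^+ 2.
  have -> : z2 - z1 = (z2 - y) + (y - z1) by rewrite addrA subrK.
  apply: (@le_trans _ _ ((s + s) ^+ 2)).
    by apply: sqn_triangle; [exact: ltW|exact: ltW|exact: z2s|rewrite -sqnN opprB].
  by apply: ler_sqr_mono; lra.
have := ht _ _ _ _ D'z1 Dz2 z12 uz1 vz2.
by lra.
Qed.

(** Comparison with the competitor [x0] bounds the penalty at [z] by [M - a0] plus the penalty at
    [x0]. *)
Lemma supconv_maximizer_near (D : set 'rV[R]_N) u x0 (a0 M k rho s : R) f x z (a : R) :
  is_supconv D u k f -> D x0 -> u x0 = a0%:E ->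
  (forall z (a : R), D z -> u z = a%:E -> a <= M) -> 0 < k -> 0 <= rho -> 0 <= s ->
  M - a0 <= k * rho ^+ 2 ->
  sqn (x - x0) <= s ^+ 2 -> D z -> u z = a%:E -> f x = a - k * sqn (z - x) ->
  sqn (z - x) <= (rho + s) ^+ 2.
Proof.
move=> sc Dx0 ux0 hM k0 rho0 s0 kM xs Dz uz fx.
have := sc.2 x x0 Dx0; rewrite ux0 lee_fin fx => h.
have := hM _ _ Dz uz => aM.
rewrite -(ler_pM2l k0).
have : k * sqn (x0 - x) <= k * s ^+ 2 by rewrite ler_pM2l // -sqnN opprB.
have : 0 <= k * (rho * s) by rewrite !mulr_ge0 // ltW.
by lra.
Qed.

Lemma eball_interior x0 (s t : R) z d : 0 <= s -> 0 <= t -> eball x0 s z ->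
  sqn d <= t ^+ 2 -> eball x0 (s + t) (z + d).
Proof.
move=> s0 t0 zs dt; rewrite /eball /=.
have -> : z + d - x0 = (z - x0) + d by rewrite addrAC.
exact: sqn_triangle.
Qed.

Lemma box_sqn x0 (r : R) x : 0 <= r -> box x0 r x -> sqn (x - x0) <= (N%:R * r) ^+ 2.
Proof.
move=> r0 h; apply: (@le_trans _ _ (N%:R * r ^+ 2)).
  by apply: sqn_le_coord => i; rewrite !mxE; exact: h.
have -> : (N%:R * r) ^+ 2 = N%:R * (N%:R * r ^+ 2) by ring.
by rewrite ler_pM2l ?ltr0n // ler_peMl ?sqr_ge0 // ler1n.
Qed.

(** [touch_sum] is applied to the sup-convolutions of [u] and [v] for large [k], and its quadratics
    are carried back by [supconv_touch]. Values only improve, since the penalties are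
    nonnegative. *)
Lemma touch_sum_usc u v x0 (rho0 a0 b0 c delta eps : R) :
  0 < rho0 -> usc_on (eball x0 rho0) u -> usc_on (eball x0 rho0) v ->
  u x0 = a0%:E -> v x0 = b0%:E -> 0 < c ->
  (forall z (a b : R), eball x0 rho0 z -> u z = a%:E -> v z = b%:E ->
     a + b <= a0 + b0 - c * sqn (z - x0)) ->
  0 < delta -> 0 < eps ->
  exists z1 z2 b1 b2 A B (a b r : R),
    [/\ eball x0 rho0 z1, eball x0 rho0 z2, u z1 = a%:E & v z2 = b%:E] /\
    [/\ symmx A, symmx B, 0 < r & a0 + b0 - eps <= a + b] /\
    [/\ forall d, sqn d <= r ^+ 2 -> (u (z1 + d)%R <= (a + dot b1 d + form A d / 2)%:E)%E,
        forall d, sqn d <= r ^+ 2 -> (v (z2 + d)%R <= (b + dot b2 d + form B d / 2)%:E)%E &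
        forall d, form A d + form B d <= delta * sqn d].
Proof.
move=> rho00 uu uv ux0 vx0 c0 hmax delta0 eps0.
set n : R := N%:R; have n0 : 0 < n by rewrite ltr0n.
have n1 : 1 <= n by rewrite ler1n.
set D := eball x0 rho0; have Dx0 : D x0 by exact: eball_center.
have cD : compact D by exact: compact_eball.
(* Touching points lie within [3 * n * rho] of [x0] and maximizers within a further
   [rho + 3 * n * rho], so within [7 * n * rho] in all; [n * rho] remains for the displacement
   [d]. *)
set rho := rho0 / (8 * n).
have rho_gt0 : 0 < rho by rewrite divr_gt0 // mulr_gt0.
have rhoE : rho0 = 8 * n * rho by rewrite /rho mulrC divfK // gt_eqF // mulr_gt0.
have [Mu hMu] := usc_bounded_above cD uu Dx0 ux0.
have [Mv hMv] := usc_bounded_above cD uv Dx0 vx0.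
have [k0 [kappa [kap0 far]]] := supconv_sum_far cD Dx0 uu uv ux0 vx0 c0 rho_gt0 hmax.
have r20 : 0 < rho ^+ 2 by rewrite exprn_gt0.
set k := 1 + `|k0| + `|(Mu - a0) / rho ^+ 2| + `|(Mv - b0) / rho ^+ 2|.
have k_gt0 : 0 < k by rewrite /k -!addrA ltr_pwDl // !addr_ge0.
have [g1 g2 g3] : [/\ k0 <= k, (Mu - a0) / rho ^+ 2 <= k & (Mv - b0) / rho ^+ 2 <= k].
  have := ler_norm k0; have := ler_norm ((Mu - a0) / rho ^+ 2).
  have := ler_norm ((Mv - b0) / rho ^+ 2); rewrite /k.
  move: (normr_ge0 k0) (normr_ge0 ((Mu - a0) / rho ^+ 2)).
  move: (normr_ge0 ((Mv - b0) / rho ^+ 2)).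
  move: (`|_|) (`|_|) (`|_|) => p q r; move: (_ / _) (_ / _) => p' q'.
  by clear; split; lra.
have ku : Mu - a0 <= k * rho ^+ 2 by rewrite -ler_pdivrMr.
have kv : Mv - b0 <= k * rho ^+ 2 by rewrite -ler_pdivrMr.
have [f scf] := sup_convolution k cD uu Dx0 ux0.
have [g scg] := sup_convolution k cD uv Dx0 vx0.
rewrite -/(is_supconv D u k f) in scf; rewrite -/(is_supconv D v k g) in scg.
clearbody k.
have hD z : D z -> sqn (z - x0) <= rho0 ^+ 2 by [].
have cf := supconv_continuous scf (ltW k_gt0) (ltW rho00) hD.
have cg := supconv_continuous scg (ltW k_gt0) (ltW rho00) hD.
have wc : a0 + b0 <= f x0 + g x0.
  have := scf.2 x0 x0 Dx0; have := scg.2 x0 x0 Dx0.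
  by rewrite subrr sqn0 mulr0 !addr0 ux0 vx0 !lee_fin; lra.
have wb y : box x0 (5 * rho) y -> (exists i, rho <= `|y ord0 i - x0 ord0 i|) ->
    f y + g y <= a0 + b0 - kappa.
  move=> _ [i hi]; apply: (far k) => //.
  apply: le_trans (ler_sqr_mono (ltW rho_gt0) hi) _.
  have -> : y ord0 i - x0 ord0 i = (y - x0) ord0 i by rewrite !mxE.
  rewrite real_normK ?num_real // /sqn /dot (bigD1 i) //= -expr2 lerDl.
  by apply: sumr_ge0 => j _; rewrite -expr2 sqr_ge0.
have r50 : 0 <= 5 * rho by rewrite mulr_ge0 // ltW.
have nr50 : 0 <= n * (5 * rho) by rewrite mulr_ge0 // ltW.
have ug eta : 0 < eta -> exists2 h, 0 < h & forall x y,
     box x0 (5 * rho) x -> box x0 (5 * rho) y -> sqn (x - y) <= h ^+ 2 ->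
     g x - g y <= eta.
  move=> eta0.
  have C0 : 0 <= 2 * k * (rho0 + n * (5 * rho)).
    by rewrite mulr_ge0 ?addr_ge0 // ?mulr_ge0 // ltW.
  have [h [h0 _ hh]] := small_step C0 (ltW k_gt0) eta0.
  exists h => // x y xb _ xy; apply: le_trans (ltW hh).
  apply: (supconv_diff_le scg (ltW k_gt0) (ltW rho00) nr50 (ltW h0) hD).
    exact: box_sqn.
  by rewrite -sqnN opprB.
have [x1 [r1 [b1 [A [x2 [r2 [b2 [B [[x1b r10 sA t1] [[x2b r20' sB t2] [AB val]]]]]]]]]]] :=
  touch_sum N_gt0 cf cg k_gt0 (supconv_semiconvex scf) (supconv_semiconvex scg)
   rho_gt0 kap0 wc wb ug delta0 eps0.
have [z1 [a [Dz1 uz1 fx1]]] := scf.1 x1; have [z2 [b [Dz2 vz2 gx2]]] := scg.1 x2.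
have r30 : 0 <= 3 * rho by rewrite mulr_ge0 // ltW.
have nr30 : 0 <= n * (3 * rho) by rewrite mulr_ge0 // ltW.
have x1s := box_sqn r30 x1b; have x2s := box_sqn r30 x2b; rewrite -/n in x1s x2s.
have z1x := supconv_maximizer_near scf Dx0 ux0 hMu k_gt0 (ltW rho_gt0) nr30 ku x1s Dz1 uz1 fx1.
have z2x := supconv_maximizer_near scg Dx0 vx0 hMv k_gt0 (ltW rho_gt0) nr30 kv x2s Dz2 vz2 gx2.
have sum0 : 0 <= rho + n * (3 * rho) by rewrite addr_ge0 // ltW.
have nrho : rho <= n * rho by rewrite ler_peMl // ltW.
have inner x z : sqn (x - x0) <= (n * (3 * rho)) ^+ 2 ->
    sqn (z - x) <= (rho + n * (3 * rho)) ^+ 2 -> eball x0 (7 * n * rho) z.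
  move=> xs zx; rewrite /eball /=.
  have -> : z - x0 = (z - x) + (x - x0) by rewrite addrA subrK.
  apply: le_trans (sqn_triangle sum0 nr30 zx xs) _.
  apply: ler_sqr_mono; first by rewrite addr_ge0.
  by clear -nrho; lra.
have z1i := inner _ _ x1s z1x; have z2i := inner _ _ x2s z2x.
have n70 : 0 <= 7 * n * rho := mulr_ge0 (mulr_ge0 (ler0n _ 7) (ltW n0)) (ltW rho_gt0).
set r := Num.min rho (Num.min r1 r2).
have r_gt0 : 0 < r by rewrite !lt_min rho_gt0 r10.
have rr : r <= rho by rewrite ge_min lexx.
have rr1 : r <= r1 by rewrite !ge_min lexx orbT.
have rr2 : r <= r2 by rewrite !ge_min lexx !orbT.
have Dd z d : eball x0 (7 * n * rho) z -> sqn d <= r ^+ 2 -> D (z + d).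
  move=> zi dr; have := eball_interior n70 (ltW r_gt0) zi dr.
  rewrite /D /eball /= => h; apply: le_trans h _; apply: ler_sqr_mono.
    by rewrite addr_ge0 // ltW.
  by rewrite rhoE; clear -rr nrho; lra.
exists z1, z2, b1, b2, A, B, a, b, r; split; first by split.
split; [split => //|split => // d dr].
- have := mulr_ge0 (ltW k_gt0) (sqn_ge0 (z1 - x1)).
  have := mulr_ge0 (ltW k_gt0) (sqn_ge0 (z2 - x2)).
  by move: val; rewrite fx1 gx2; clear; lra.
- apply: (supconv_touch scf Dz1 uz1 fx1 t1); last exact: Dd.
  by apply: le_trans dr _; apply: ler_sqr_mono => //; exact: ltW.
- apply: (supconv_touch scg Dz2 vz2 gx2 t2); last exact: Dd.
  by apply: le_trans dr _; apply: ler_sqr_mono => //; exact: ltW.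
Qed.

End SumOfUsc.

(** * One-variable derivatives and the mean value theorem *)

Section Calculus.
Context {R : realType}.

(** The difference quotient is exactly [al + h * be] for nonzero [h], so its limit is immediate. *)
Lemma is_derive_of_quadratic (V : normedModType R) (f : V -> R) (x v : V) (al be : R) :
  (forall h : R, f (h *: v + x) = f x + h * al + h ^+ 2 * be) -> is_derive x v f al.
Proof.
move=> hf.
have c : (fun h : R => h^-1 *: ((f \o shift x) (h *: v) - f x)) @ 0^' --> al.
  have c1 : (fun h : R => al + h * be) @ 0^' --> al.
    have : (fun h : R => al + h * be) @ (0 : R) --> al + 0 * be.
      apply: cvgD; first exact: cvg_cst.
      by apply: cvgM; [exact: cvg_id|exact: cvg_cst].
    by rewrite mul0r addr0; apply: cvg_trans; apply: cvg_fmap2; exact: cvg_within.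
  apply: cvg_trans c1; apply: near_eq_cvg.
  near=> h; rewrite /= hf.
  have h0 : h != 0 by near: h; exact: nbhs_dnbhs_neq.
  by rewrite /GRing.scale /=; field.
split; first by apply/cvg_ex; exists al.
exact: cvg_lim c.
Unshelve. all: by end_near. Qed.

Lemma is_derive_line (V : normedModType R) (f : V -> R) (y v : V) (t : R) :
  derivable f (y + t *: v) v ->
  is_derive t 1 (fun s : R => f (y + s *: v)) ('D_v f (y + t *: v)).
Proof.
move=> df.
have e : (fun h : R => h^-1 *: (((fun s : R => f (y + s *: v)) \o shift t) (h *: 1) - f (y + t *: v)))
   = (fun h : R => h^-1 *: ((f \o shift (y + t *: v)) (h *: v) - f (y + t *: v))).
  apply/funext => h /=; congr (_ *: (f _ - _)).
  by rewrite [h *: 1]mulr1 scalerDl addrCA.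
by split; rewrite /derivable /derive e.
Qed.

(** Mean value theorem for [f] minus its quadratic model, whose derivative is bounded by [eta]. *)
Lemma mvt_quadratic (f df : R -> R) (s al be eta : R) :
  (forall t : R, `|t| <= `|s| -> is_derive t 1 f (df t)) ->
  (forall t : R, `|t| <= `|s| -> `|df t - al - be * t| <= eta) ->
  `|f s - f 0 - al * s - be * s ^+ 2 / 2| <= eta * `|s|.
Proof.
move=> hd hb.
pose q := fun t : R => al * t + be * t ^+ 2 / 2.
have dq (t : R) : is_derive t 1 q (al + be * t).
  apply: (@is_derive_of_quadratic _ q t 1 (al + be * t) (be / 2)) => h.
  by rewrite /q [h *: 1]mulr1; field.
have dg (t : R) : `|t| <= `|s| -> is_derive t 1 (f - q) (df t - (al + be * t)).
  by move=> ts; apply: is_deriveB; exact: hd.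
have key (a b : R) : a <= b -> (forall t, a <= t <= b -> `|t| <= `|s|) ->
   `|(f - q) b - (f - q) a| <= eta * (b - a).
  move=> ab hab.
  have [||c cab ->] := @MVT_segment R (f - q) (fun t => df t - (al + be * t)) a b ab.
  - move=> t; rewrite in_itv /= => /andP[at_ tb]; apply: dg; apply: hab.
    by rewrite !ltW.
  - apply: derivable_within_continuous => t; rewrite in_itv /= => tab.
    by apply: ex_derive; exact: dg (hab _ tab).
  rewrite in_itv /= in cab.
  rewrite normrM (ger0_norm (_ : 0 <= b - a)) ?subr_ge0 // ler_wpM2r ?subr_ge0 //.
  by rewrite opprD addrA; exact: hb (hab _ cab).
have e : f s - f 0 - al * s - be * s ^+ 2 / 2 = (f - q) s - (f - q) 0.
  by rewrite !fctE /= /q; ring.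
rewrite e; have [s0|s0] := leP 0 s.
  have h t : 0 <= t <= s -> `|t| <= `|s| by move=> /andP[t0 ts]; rewrite !ger0_norm.
  by have := key 0 s s0 h; rewrite subr0 (ger0_norm s0).
have h t : s <= t <= 0 -> `|t| <= `|s|.
  by move=> /andP[st t0]; rewrite ler0_norm // ltr0_norm // lerN2.
by have := key s 0 (ltW s0) h; rewrite sub0r distrC (ltr0_norm s0).
Qed.

End Calculus.

(** * Increments along coordinate paths *)

Section Taylor.
Context {R : realType} {N : nat}.
Implicit Types (x y z d b p : 'rV[R]_N) (A H : 'M[R]_N).

Definition truncv (m : nat) d : 'rV[R]_N := \row_i (if (i < m)%N then d ord0 i else 0).

Lemma truncv0 d : truncv 0 d = 0.
Proof. by apply/rowP => i; rewrite !mxE. Qed.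

Lemma truncvN d : truncv N d = d.
Proof. by apply/rowP => i; rewrite !mxE ltn_ord. Qed.

Lemma truncvS (m : 'I_N) d : truncv m.+1 d = truncv m d + d ord0 m *: evec R m.
Proof.
apply/rowP => i; rewrite !mxE eqxx /= ltnS leq_eqVlt (_ : (i == m) = (val i == val m)) //.
case: (ltngtP (val i) (val m)) => im /=; rewrite ?mulr0 ?addr0 //.
by rewrite mulr1 add0r; congr (d _ _); exact: val_inj.
Qed.

(** The path from [x0] to [x0 + d] runs through the truncations of [d], one coordinate at a time, so
    partial derivatives suffice. Each edge costs [eta * s], and symmetry of [H] assembles the cross
    terms into [form H]. *)
Lemma derivable_increment (psi : 'rV[R]_N -> R) x0 (s eta : R) p H d : symmx H ->
  (forall i, `|d ord0 i| <= s) ->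
  (forall x, box x0 s x -> forall i, derivable psi x (evec R i) /\
     `|pd i psi x - p ord0 i - ((x - x0) *m H) ord0 i| <= eta) ->
  `|psi (x0 + d) - psi x0 - dot p d - form H d / 2| <= N%:R * (eta * s).
Proof.
move=> sH ds hpsi.
suff ind m : (m <= N)%N ->
    `|psi (x0 + truncv m d) - psi x0 - dot p (truncv m d) - form H (truncv m d) / 2|
      <= m%:R * (eta * s).
  by have := ind N (leqnn _); rewrite truncvN.
elim: m => [_|m IHm mN].
  rewrite truncv0 addr0 subrr dot0r /form dot0r !mul0r !subr0 normr0.
  by rewrite lexx.
have {IHm} := IHm (ltnW mN).
have -> : truncv m.+1 d = truncv m d + d ord0 (Ordinal mN) *: evec R (Ordinal mN).
  exact: (truncvS (Ordinal mN)).
set i := Ordinal mN; set y := truncv m d; set e := evec R i; set c := d ord0 i => IHm.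
have yi : y ord0 i = 0 by rewrite mxE /= ltnn.
have yb j : `|y ord0 j| <= s.
  by rewrite mxE; case: ifP => _ //; rewrite normr0 (le_trans _ (ds j)).
clearbody y.
have ybox (t : R) : `|t| <= `|c| -> box x0 s (x0 + y + t *: e).
  move=> tc j.
  have -> : (x0 + y + t *: e) ord0 j - x0 ord0 j = y ord0 j + t * (j == i)%:R.
    by rewrite !mxE eqxx /=; ring.
  have [->|ji] := eqVneq j i; last by rewrite mulr0 addr0.
  by rewrite yi add0r mulr1; exact: le_trans tc (ds i).
have step := @mvt_quadratic R (fun t => psi (x0 + y + t *: e))
   (fun t => pd i psi (x0 + y + t *: e)) c (p ord0 i + (y *m H) ord0 i) (H i i) eta.
have : `|psi (x0 + y + c *: e) - psi (x0 + y) - (p ord0 i + (y *m H) ord0 i) * c -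
    H i i * c ^+ 2 / 2| <= eta * `|c|.
  have := step; rewrite scale0r addr0; apply => t tc.
    by apply: is_derive_line; have [] := hpsi _ (ybox t tc) i.
  have [_] := hpsi _ (ybox t tc) i.
  have -> : ((x0 + y + t *: e - x0) *m H) ord0 i = (y *m H) ord0 i + H i i * t.
    have -> : x0 + y + t *: e - x0 = y + t *: e by apply/rowP => j; rewrite !mxE; ring.
    by rewrite mulmxDl -scalemxAl -rowE !mxE mulrC.
  by rewrite opprD addrA opprD addrA.
have eta0 : 0 <= eta.
  have b0 : box x0 s (x0 + y + 0 *: e) by apply: ybox; rewrite normr0.
  by have [_] := hpsi _ b0 i; apply: le_trans.
have cs : eta * `|c| <= eta * s by apply: ler_wpM2l => //; exact: ds.
rewrite addrA dotDr dotZr dot_evec formD // formZ form_evec dotZr dot_evec.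
have -> : m.+1%:R * (eta * s) = m%:R * (eta * s) + eta * s by rewrite -(natr1 m); ring.
set a1 := psi (x0 + y + c *: e); set a2 := psi (x0 + y); set a3 := psi x0.
move: IHm; rewrite -/a2 -/a3 => IHm h.
have -> : a1 - a3 - (dot p y + c * p ord0 i) -
   (form H y + 2 * (c * (y *m H) ord0 i) + c ^+ 2 * H i i) / 2 =
   (a2 - a3 - dot p y - form H y / 2) +
   (a1 - a2 - (p ord0 i + (y *m H) ord0 i) * c - H i i * c ^+ 2 / 2) by field.
apply: le_trans (ler_normD _ _) _; apply: lerD => //.
exact: le_trans h cs.
Qed.

End Taylor.

(** * Symmetry of the Hessian and second-order Taylor expansion *)

Section SecondOrder.
Context {R : realType} {N : nat}.
Implicit Types (x y z d b p : 'rV[R]_N) (A H : 'M[R]_N).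

Lemma nbhs_box x0 (P : set 'rV[R]_N) : nbhs x0 P ->
  exists2 r : R, 0 < r & forall x, box x0 r x -> P x.
Proof.
move=> /nbhs_ballP[e /= e0 h]; exists (e / 2); first by rewrite divr_gt0.
move=> x xb; apply: h; rewrite -ball_normE /=.
apply: (@le_lt_trans _ _ (e / 2)); last by lra.
by apply: normr_rV_le => [|i]; [lra|rewrite !mxE distrC; exact: xb].
Qed.

Lemma near_forall (T : topologicalType) (I : finType) (x : T) (P : I -> T -> Prop) :
  (forall i, \forall y \near x, P i y) -> \forall y \near x, forall i, P i y.
Proof. by move=> h; apply: filter_forall. Qed.

Lemma C2_box phi x0 (eps : R) : C2_near phi x0 -> 0 < eps ->
  exists2 r : R, 0 < r & forall x, box x0 r x -> forall i j,
    [/\ derivable phi x (evec R i), derivable (pd i phi) x (evec R j) &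
      `|pd j (pd i phi) x - hessian phi x0 i j| <= eps].
Proof.
move=> [U [oU Ux0 hU]] e0.
have nU : nbhs x0 U by apply: open_nbhs_nbhs; split.
have near_ij : \forall x \near x0, forall ij : 'I_N * 'I_N,
    U x /\ `|pd ij.2 (pd ij.1 phi) x0 - pd ij.2 (pd ij.1 phi) x| < eps.
  apply: near_forall => -[i j] /=; apply: filterI => //.
  have [_ _ hc] := hU _ Ux0; have [_] := hc i j.
  by move/cvgrPdist_lt/(_ _ e0).
have [r r0 h] := nbhs_box near_ij; exists r => // x xb i j.
have [Ux hx] := h x xb (i, j); have [_ d1 d2] := hU _ Ux.
split; [exact: (d1 i).1|exact: (d2 i j).1|].
by rewrite distrC mxE ltW.
Qed.

Lemma C2_gradient phi x0 (eps : R) : C2_near phi x0 -> 0 < eps ->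
  exists2 r : R, 0 < r &
    (forall x, box x0 r x -> forall i, derivable phi x (evec R i)) /\
    forall d (s : R) i, s <= r -> (forall j, `|d ord0 j| <= s) ->
      `|pd i phi (x0 + d) - pd i phi x0 - dot (row i (hessian phi x0)) d|
        <= N%:R * (eps * s).
Proof.
move=> C2 e0; have [r r0 h] := C2_box C2 e0; exists r => //; split.
  by move=> x xb i; have [] := h x xb i i.
move=> d s i sr ds; set H := hessian phi x0 in h *.
have s0 : symmx (0 : 'M[R]_N) by exact: trmx0.
have := @derivable_increment R N (pd i phi) x0 s eps (row i H) 0 d s0 ds.
rewrite /form mulmx0 dot0l mul0r subr0; apply => x xs j.
have [_ d2 hb] := h x (box_le sr xs) i j; split => //.
by rewrite mulmx0 !mxE subr0; move: hb; rewrite mxE.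
Qed.

Definition second_difference phi x0 i j (t : R) : R :=
  phi (x0 + t *: evec R j + t *: evec R i) - phi (x0 + t *: evec R i)
  - phi (x0 + t *: evec R j) + phi x0.

(** The second difference is the increment in direction [i] of a difference of two parallel
    restrictions, whose derivative is [t * H i j] up to the error from [C2_gradient]. *)
Lemma second_difference_approx phi x0 (eps r t : R) i j :
  (forall x, box x0 r x -> forall i, derivable phi x (evec R i)) ->
  (forall d (s : R) i, s <= r -> (forall j, `|d ord0 j| <= s) ->
      `|pd i phi (x0 + d) - pd i phi x0 - dot (row i (hessian phi x0)) d|
        <= N%:R * (eps * s)) ->
  0 < t -> 2 * t <= r ->
  `|second_difference phi x0 i j t - hessian phi x0 i j * t ^+ 2|
     <= 4 * N%:R * eps * t ^+ 2.
Proof.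
move=> hd hg t0 tr; set H := hessian phi x0 in hg *; clearbody H.
have evb l m : `|(evec R l : 'rV[R]_N) ord0 m| <= 1.
  by rewrite mxE eqxx /= normr_nat lern1; case: eqP.
have b1 (s : R) m : `|s| <= `|t| -> `|(s *: evec R i : 'rV[R]_N) ord0 m| <= 2 * t.
  move=> st; rewrite mxE normrM; rewrite (gtr0_norm t0) in st.
  have := ler_pM (normr_ge0 _) (normr_ge0 _) st (evb i m); lra.
have b2 (s : R) m : `|s| <= `|t| ->
    `|(t *: evec R j + s *: evec R i : 'rV[R]_N) ord0 m| <= 2 * t.
  move=> st; rewrite mxE; apply: le_trans (ler_normD _ _) _.
  rewrite !mxE !normrM eqxx /= !normr_nat; rewrite (gtr0_norm t0) in st *.
  have e1 : t * (m == j)%:R <= t * 1 by rewrite ler_pM2l // lern1; case: eqP.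
  have e2 : `|s| * (m == i)%:R <= t * 1.
    by rewrite ler_pM // ?lern1; case: eqP.
  by lra.
have box1 d : (forall m, `|d ord0 m| <= 2 * t) -> box x0 r (x0 + d).
  move=> db m; rewrite mxE (addrC (x0 _ _)) addrK; exact: le_trans (db m) tr.
have step := @mvt_quadratic R
   ((fun s => phi (x0 + t *: evec R j + s *: evec R i)) - (fun s => phi (x0 + s *: evec R i)))
   (fun s => pd i phi (x0 + t *: evec R j + s *: evec R i) - pd i phi (x0 + s *: evec R i))
   t (t * H i j) 0 (4 * N%:R * eps * t).
have : `|second_difference phi x0 i j t - t * H i j * t - 0 * t ^+ 2 / 2|
    <= 4 * N%:R * eps * t * `|t|.
  have -> : second_difference phi x0 i j t =
     phi (x0 + t *: evec R j + t *: evec R i) - phi (x0 + t *: evec R i) -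
     (phi (x0 + t *: evec R j) - phi x0) by rewrite /second_difference; ring.
  move: step; rewrite !fctE !scale0r !addr0; apply => s st.
    apply: is_deriveB; apply: is_derive_line; apply: hd.
      by rewrite -addrA; apply: box1 => m; exact: b2.
    by apply: box1 => m; exact: b1.
  have h1 := hg _ _ i tr (fun m => b2 s m st); have h2 := hg _ _ i tr (fun m => b1 s m st).
  rewrite -(addrA x0).
  move: h1 h2; rewrite !(dotDr, dotZr, dot_evec) !ler_norml.
  rewrite (mxE _ _ _ j) (mxE _ _ _ i).
  move: (pd i phi (_ + _)) (pd i phi (_ + _)) (pd i phi x0) (H i j) (H i i).
  by clear; move=> *; lra.
rewrite (gtr0_norm t0).
have -> : second_difference phi x0 i j t - t * H i j * t - 0 * t ^+ 2 / 2 =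
   second_difference phi x0 i j t - H i j * t ^+ 2 by ring.
by move=> h; apply: le_trans h _; rewrite expr2 mulrA.
Qed.

(** Schwarz's theorem: the second difference is symmetric in [i] and [j], while divided by [t ^+ 2]
    it approximates both [H i j] and [H j i]. *)
Lemma hessian_sym phi x0 : C2_near phi x0 -> symmx (hessian phi x0).
Proof.
move=> C2; apply/matrixP => i j; rewrite [LHS]mxE.
set H := hessian phi x0.
apply/eqP; rewrite -subr_eq0 -normr_le0; apply/ler_addgt0Pr => e e0; rewrite add0r.
have e8 : 0 < e / (8 * (N%:R + 1)) by rewrite divr_gt0 // mulr_gt0 // ltr_wpDl.
have [r r0 [hd hg]] := C2_gradient C2 e8.
have t0 : 0 < r / 2 by rewrite divr_gt0.
have tr : 2 * (r / 2) <= r by lra.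
have h1 := second_difference_approx i j hd hg t0 tr.
have h2 := second_difference_approx j i hd hg t0 tr.
have sw : second_difference phi x0 j i (r / 2) = second_difference phi x0 i j (r / 2).
  rewrite /second_difference (addrAC x0); ring.
rewrite sw -/H in h1 h2.
set S := second_difference _ _ _ _ _ in h1 h2; set t := r / 2 in t0 h1 h2.
have t20 : 0 < t ^+ 2 by rewrite exprn_gt0.
have ne : N%:R * (e / (8 * (N%:R + 1))) <= e / 8.
  have -> : N%:R * (e / (8 * (N%:R + 1))) = e / 8 * (N%:R / (N%:R + 1)).
    by field; rewrite gt_eqF // ltr_wpDl.
  by rewrite ler_piMr ?divr_ge0 ?(ltW e0) // ler_pdivrMr ?ltr_wpDl // mul1r lerDl.
rewrite -(ler_pM2l t20).
have ne4 : 4 * N%:R * (e / (8 * (N%:R + 1))) * t ^+ 2 <= 4 * (e / 8) * t ^+ 2.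
  by rewrite ler_pM2r // -mulrA ler_pM2l.
rewrite -[X in X * `|_|]gtr0_norm // -normrM.
have := le_trans h1 ne4; have := le_trans h2 ne4.
by rewrite !ler_norml; lra.
Qed.

Lemma C2_taylor phi x0 (eps : R) : (0 < N)%N -> C2_near phi x0 -> 0 < eps ->
  exists2 r : R, 0 < r & exists p, forall d, sqn d <= r ^+ 2 ->
    phi (x0 + d) <= phi x0 + dot p d + form (hessian phi x0) d / 2 + eps * sqn d.
Proof.
move=> N0 C2 e0; set H := hessian phi x0.
have n0 : 0 < N%:R :> R by rewrite ltr0n.
(* Two passes over the coordinates, one for the gradient and one for the function, each lose a
   factor [N]. *)
have e1 : 0 < eps / N%:R ^+ 2 by rewrite divr_gt0 // exprn_gt0.
have [r r0 [hd hg]] := C2_gradient C2 e1.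
have sH := hessian_sym C2.
exists r => //; exists (\row_i pd i phi x0) => d dr.
(* Working in the box of radius exactly the length of [d], rather than [r], makes the error
   proportional to [sqn d]. *)
set s := Num.sqrt (sqn d); have ss : s ^+ 2 = sqn d by rewrite sqr_sqrtr // sqn_ge0.
have s0 : 0 <= s by exact: sqrtr_ge0.
have sr : s <= r by rewrite -(@ler_pXn2r _ 2) ?nnegrE // ?ss // ltW.
have ds i : `|d ord0 i| <= s by apply: coord_le_sqn => //; rewrite ss.
have := @derivable_increment R N phi x0 s (N%:R * (eps / N%:R ^+ 2 * s)) (\row_i pd i phi x0) H d sH ds.
have -> : N%:R * (N%:R * (eps / N%:R ^+ 2 * s) * s) = eps * sqn d.
  by rewrite -ss; field; rewrite gt_eqF.
move=> h; have : `|phi (x0 + d) - phi x0 - dot (\row_i pd i phi x0) d - form H d / 2|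
    <= eps * sqn d.
  apply: h => x xs i; split; first by apply: hd; exact: box_le xs.
  have xd m : `|(x - x0) ord0 m| <= s by rewrite !mxE; exact: xs.
  have := hg (x - x0) s i sr xd; rewrite (addrC x0) subrK.
  have -> : dot (row i (hessian phi x0)) (x - x0) = ((x - x0) *m H) ord0 i.
    rewrite /dot [RHS]mxE; apply: eq_bigr => m _; rewrite mulrC [row _ _ _ _]mxE.
    by rewrite -[in LHS]sH [_^T _ _]mxE.
  by rewrite [(\row_ _ _) _ _]mxE.
by rewrite ler_norml; lra.
Qed.

End SecondOrder.

(** * Touching quadratics as test functions *)

Section QuadraticJets.
Context {R : realType} {N : nat}.
Implicit Types (x y z d b : 'rV[R]_N) (A : 'M[R]_N).

Definition quad (a : R) b A z y : R := a + (dot b (y - z) + 2^-1 * form A (y - z)).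

Lemma continuous_quad a b A z : continuous (quad a b A z).
Proof.
apply: continuous_funD; first exact: continuous_funC.
apply: continuous_funD; first exact: continuous_dotB.
by apply: continuous_funM; [exact: continuous_funC|exact: continuous_formB].
Qed.

Lemma quad_derive a b A z x i : symmx A ->
  is_derive x (evec R i) (quad a b A z) (b ord0 i + ((x - z) *m A) ord0 i).
Proof.
move=> sA; apply: (@is_derive_of_quadratic R _ _ _ _ _ (A i i / 2)) => h.
have e : h *: evec R i + x - z = (x - z) + h *: evec R i by rewrite -addrA addrC.
rewrite /quad e formD // !(dotDr, dotZr) !dot_evec formZ form_evec.
by field.
Qed.

Lemma pd_quad a b A z i : symmx A ->
  pd i (quad a b A z) = fun x => b ord0 i + ((x - z) *m A) ord0 i.
Proof. by move=> sA; apply/funext => x; exact: (@derive_val _ _ _ _ _ _ _ (quad_derive a b z x i sA)). Qed.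

Lemma pd_quad_derive b A z x i j :
  is_derive x (evec R j) (fun x => b ord0 i + ((x - z) *m A) ord0 i) (A j i).
Proof.
apply: (@is_derive_of_quadratic R _ _ _ _ _ 0) => h.
have e : h *: evec R j + x - z = (x - z) + h *: evec R j by rewrite -addrA addrC.
rewrite e.
have -> : ((x - z + h *: evec R j) *m A) ord0 i = ((x - z) *m A) ord0 i + h * A j i.
  by rewrite mulmxDl -scalemxAl -rowE !mxE.
by ring.
Qed.

Lemma pd_pd_quad a b A z i j : symmx A ->
  pd j (pd i (quad a b A z)) = fun=> A j i.
Proof.
by move=> sA; apply/funext => x; rewrite pd_quad //; exact: (@derive_val _ _ _ _ _ _ _ (pd_quad_derive b A z x i j)).
Qed.

Lemma hessian_quad a b A z x : symmx A -> hessian (quad a b A z) x = A.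
Proof.
by move=> sA; apply/matrixP => i j; rewrite mxE pd_pd_quad // -[in LHS]sA mxE.
Qed.

Lemma C2_quad a b A z : symmx A -> C2_near (quad a b A z) z.
Proof.
move=> sA; exists setT; split => //; first exact: openT.
move=> x _; split; first exact: continuous_quad.
  move=> i; split; first exact: (@ex_derive _ _ _ _ _ _ _ (quad_derive a b z x i sA)).
  rewrite pd_quad //; apply: continuous_funD; first exact: continuous_funC.
  rewrite (_ : (fun y => _) = fun y : 'rV[R]_N => \sum_j (y - z) ord0 j * A j i).
    apply: continuous_sumr => j; apply: continuous_funM; last exact: continuous_funC.
    exact: continuous_coordB.
  by apply/funext => y; rewrite mxE.
move=> i j; split; last by rewrite pd_pd_quad //; exact: continuous_funC.
by rewrite pd_quad //; exact: (@ex_derive _ _ _ _ _ _ _ (pd_quad_derive b A z x i j)).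
Qed.

(** The touching quadratic is itself an admissible test function; the gradient [b] disappears from
    the jet. *)
Lemma quad_jet (u : 'rV[R]_N -> \bar R) z (a r : R) b A : symmx A -> 0 < r ->
  u z = a%:E ->
  (forall d, sqn d <= r ^+ 2 -> (u (z + d)%R <= (a + dot b d + form A d / 2)%:E)%E) ->
  Jplus u z (a, A).
Proof.
move=> sA r0 uz h; have qz : quad a b A z z = a.
  by rewrite /quad subrr dot0r /form dot0r mulr0 !addr0.
exists (quad a b A z); split; rewrite ?qz ?hessian_quad //; first exact: C2_quad.
move: (near_sqn z r0); apply: filterS => y yr.
have := h _ yr; rewrite (addrC z) subrK => h1; apply: le_trans h1 _.
by rewrite lee_fin /quad; lra.
Qed.

End QuadraticJets.

(** * Fibres of elliptic maps and their duals *)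

Section EllipticMaps.
Context {R : realType} {N : nat}.
Hypothesis N_gt0 : (0 < N)%N.
Implicit Types (p q m : R * 'M[R]_N) (S T : set (R * 'M[R]_N)).

Lemma hausdorff_near S T (eta : R) p : (hausdorff S T < eta%:E)%E -> S p ->
  exists2 q, T q & normRS (psub p q) < eta.
Proof.
rewrite /hausdorff gt_max => /andP[h _] Sp.
have : (pdist p T < eta%:E)%E.
  by apply: le_lt_trans h; apply: ereal_sup_ubound; exists p.
move=> /ereal_inf_lt[_ [q Tq <-]]; rewrite lte_fin => h'.
by exists q.
Qed.

(** The margin [e] in both components places the whole ball of radius [e] about [m] inside
    [q + Qcone], hence inside [S]. *)
Lemma relint_above S q m (e : R) : S `<=` @SN R N ->
  (forall p p', S p -> Qcone p' -> S (padd p p')) ->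
  S q -> SN m -> 0 < e -> m.1 + e <= q.1 ->
  (forall v, form q.2 v + e * sqn v <= form m.2 v) -> relint S m.
Proof.
move=> sS cS Sq Sm e0 h1 h2; split => //; exists e; split => // q' Sq' hq'.
have e1 : q' = padd q (psub q' q).
  by case: q' Sq' hq' => [a A] _ _; rewrite /padd /psub /= !(addrC q.1, addrC q.2) !subrK.
rewrite e1; apply: cS => //.
have sd : symmx (psub q' m).2 by apply: symmxD => //; exact: symmxN.
have := normRS_fst (psub q' m); rewrite /= ler_norml => /andP[_ g1].
split; first by rewrite /=; lra.
split => [|v]; first by apply: symmxD => //; apply: symmxN; exact: sS.
rewrite -formE /= form_add form_opp.
have := normRS_form v N_gt0 sd; rewrite /= form_add form_opp ler_norml => /andP[g2 _].
have := h2 v; have : normRS (psub q' m) * sqn v <= e * sqn v.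
  by rewrite ler_wpM2r ?sqn_ge0 // ltW.
by lra.
Qed.

Lemma enorm_lt (x : 'rV[R]_N) (s t : R) : 0 <= s -> s < t -> sqn x <= s ^+ 2 ->
  enorm x < t.
Proof.
move=> s0 st xs; apply: le_lt_trans st; rewrite /enorm.
have -> : \sum_i x ord0 i ^+ 2 = sqn x by apply: eq_bigr => i _; rewrite expr2.
by rewrite -[leRHS](ger0_norm s0) -sqrtr_sqr ler_wsqrtr.
Qed.

Lemma nbhs_eball (x0 : 'rV[R]_N) (P : set 'rV[R]_N) : nbhs x0 P ->
  exists2 r : R, 0 < r & forall s, 0 < s -> s <= r -> eball x0 s `<=` P.
Proof.
move=> /nbhs_ballP[e /= e0 h]; exists (e / 2); first by rewrite divr_gt0.
move=> s s0 se x xb; apply: h; rewrite -ball_normE /=.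
apply: (@le_lt_trans _ _ s); last by lra.
by apply: norm_le_sqn; [exact: ltW|rewrite -sqnN opprB].
Qed.

Lemma usc_on_add (D : set 'rV[R]_N) (u v : 'rV[R]_N -> \bar R) :
  usc_on D u -> usc_on D v -> usc_on D (fun x => (u x + v x)%E).
Proof.
move=> uu uv; split => [x Dx|x Dx a].
  by have := uu.1 x Dx; have := uv.1 x Dx; case: (u x); case: (v x).
move=> /ereal_lt_dense[c [uc ca]].
have ac : 0 < a - c by lra.
have [|b1 [b2 [ub vb bb]]] := usc_split (q := a) ac (uu.1 x Dx) (uv.1 x Dx).
  by move=> b1 b2 ub vb; move: uc; rewrite ub vb -EFinD lte_fin; lra.
have := uv.2 x Dx b2 vb; have := uu.2 x Dx b1 ub; apply: filterS2 => y uy vy Dy.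
apply: lt_le_trans (lteD (uy Dy) (vy Dy)) _.
by rewrite -EFinD lee_fin.
Qed.

Lemma usc_on_subset (D D' : set 'rV[R]_N) (u : 'rV[R]_N -> \bar R) :
  D' `<=` D -> usc_on D u -> usc_on D' u.
Proof.
move=> sD [u1 u2]; split => [x /sD|x D'x a ua]; first exact: u1.
by have := u2 x (sD _ D'x) a ua; apply: filterS => y h /sD; exact: h.
Qed.

(* Ellipticity and the closeness of the two fibres would put the jet of [- ut] in the
   interior of [Th z2], against the definition of the dual map. *)
Lemma no_opposite_jets (X : set 'rV[R]_N) (Th : 'rV[R]_N -> set (R * 'M[R]_N))
    (u ut : 'rV[R]_N -> \bar R) z1 z2 (a b e : R) (A B : 'M[R]_N) :
  proper_elliptic X Th -> subharmonic Th X u -> subharmonic (dual Th) X ut ->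
  X z1 -> X z2 -> (hausdorff (Th z1) (Th z2) < e%:E)%E -> 0 < e ->
  symmx A -> symmx B -> Jplus u z1 (a, A) -> Jplus ut z2 (b, B) ->
  2 * e <= a + b -> (forall v, form A v + form B v <= - (2 * e) * sqn v) -> False.
Proof.
move=> pe [_ su] [_ sut] X1 X2 hd e0 sA sB J1 J2 ab AB.
have T1 := su _ X1 _ J1; have T2 := sut _ X2 _ J2.
have [[sS _] _ _ cS] := pe _ X2.
have [q Tq hq] := hausdorff_near hd T1.
case: T2 => m [Sm nm] [mb mB]; apply: nm.
have sd : symmx (psub (a, A) q).2 by apply: symmxD => //; apply: symmxN; exact: sS.
apply: (relint_above sS cS Tq Sm e0).
  have := normRS_fst (psub (a, A) q); rewrite /= ler_norml => /andP[_ h].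
  by have := opprK m.1; rewrite mb => <-; lra.
move=> v; have := normRS_form v N_gt0 sd; rewrite /= form_add form_opp ler_norml => /andP[h _].
have : normRS (psub (a, A) q) * sqn v <= e * sqn v by rewrite ler_wpM2r ?sqn_ge0 // ltW.
by have := AB v; rewrite -mB form_opp; lra.
Qed.

End EllipticMaps.

(** * Opposite jets and the addition theorem *)

Section SubharmonicAddition.
Context {R : realType} {N : nat}.
Hypothesis N_gt0 : (0 < N)%N.
Implicit Types (x y z d b p : 'rV[R]_N) (A B : 'M[R]_N) (u v : 'rV[R]_N -> \bar R).

(* Subtracting the linear part of the test function and adding half of its strict
   concavity turns the hypothesis into that of [touch_sum_usc]; the concavity is
   recovered on the Hessian side. *)
Lemma opposite_jets u v x0 p (rho0 a0 b0 c : R) :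
  0 < rho0 -> usc_on (eball x0 rho0) u -> usc_on (eball x0 rho0) v ->
  u x0 = a0%:E -> v x0 = b0%:E -> 0 < c -> 0 < a0 + b0 ->
  (forall z (a b : R), eball x0 rho0 z -> u z = a%:E -> v z = b%:E ->
     a + b <= a0 + b0 + dot p (z - x0) - c * sqn (z - x0)) ->
  rho0 <= 1 -> rho0 * (1 + sqn p + c) <= (a0 + b0) / 4 ->
  exists z1 z2 (a b : R) A B,
    [/\ eball x0 rho0 z1, eball x0 rho0 z2, symmx A & symmx B] /\
    [/\ Jplus u z1 (a, A), Jplus v z2 (b, B), (a0 + b0) / 4 <= a + b &
      forall d, form A d + form B d <= - (c / 2) * sqn d].
Proof.
move=> r0 uu uv ux0 vx0 c0 pos hmax r1 rs.
pose h y := - dot p (y - x0) + c / 2 * sqn (y - x0).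
have ch : continuous h.
  apply: continuous_funD; first by apply: continuous_funN; exact: continuous_dotB.
  by apply: continuous_funM; [exact: continuous_funC|exact: continuous_sqnB].
have h0 : h x0 = 0 by rewrite /h subrr dot0r sqn0 mulr0 oppr0 addr0.
pose u' y := (u y + (h y)%:E)%E.
have uu' : usc_on (eball x0 rho0) u' by exact: usc_on_add_continuous.
have u'x0 : u' x0 = a0%:E by rewrite /u' h0 ux0 adde0.
have u'E y (a : R) : u' y = a%:E -> u y = (a - h y)%:E.
  by rewrite /u'; case: (u y) => [e [<-]| |] //=; rewrite addrK.
have c20 : 0 < c / 2 by rewrite divr_gt0.
have eps0 : 0 < (a0 + b0) / 2 by rewrite divr_gt0.
have hmax' z (a b : R) : eball x0 rho0 z -> u' z = a%:E -> v z = b%:E ->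
    a + b <= a0 + b0 - c / 2 * sqn (z - x0).
  by move=> zb /u'E uz vz; have := hmax z _ _ zb uz vz; rewrite /h; lra.
have [z1 [z2 [b1 [b2 [A [B [a [b [r [[z1b z2b uz1 vz2] [[sA sB rp val] [t1 t2 AB]]]]]]]]]]]] :=
  touch_sum_usc N_gt0 r0 uu' uv u'x0 vx0 c20 hmax' c20 eps0.
(* Removing [h], whose Hessian is [c I], turns [A + B <= c / 2] into a sum at most [- c / 2]. *)
have sA' : symmx (A - c%:M) by apply: symmxD => //; apply: symmxN; exact: symmx_scalar.
exists z1, z2, (a - h z1), b, (A - c%:M), B; split => //; split.
- apply: (@quad_jet R N u z1 _ r (b1 + p - c *: (z1 - x0))) => //; first exact: u'E.
  move=> d dr; have := t1 d dr; rewrite /u' -leeBrDr // -EFinB => h1.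
  apply: le_trans h1 _; rewrite lee_fin /h.
  have -> : z1 + d - x0 = (z1 - x0) + d by rewrite addrAC.
  by rewrite sqnD form_add form_opp form_scalar !dotE; lra.
- exact: quad_jet vz2 t2.
(* [1 + sqn p] serves as a square-root-free bound on the length of [p]. *)
- have ps : sqn p <= (1 + sqn p) ^+ 2 by have := sqn_ge0 p; nra.
  have p0 : 0 <= 1 + sqn p by rewrite addr_ge0 // sqn_ge0.
  have := sqr_dot_le p0 (ltW r0) ps z1b; rewrite ler_norml => /andP[g1 _].
  have g2 : c * sqn (z1 - x0) <= c * rho0 ^+ 2 by rewrite ler_pM2l.
  have g3 : c * rho0 ^+ 2 <= c * rho0 by rewrite ler_pM2l // expr2 ler_piMl // ltW.
  have := mulr_ge0 (ltW c0) (sqn_ge0 (z1 - x0)); rewrite /h; lra.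
- move=> d; have := AB d; rewrite form_add form_opp form_scalar; lra.
Qed.

End SubharmonicAddition.

Theorem theorem5p2 (R : realType) (N : nat) (HN : (0 < N)%N)
  (X : set 'rV[R]_N) (Th : 'rV[R]_N -> set (R * 'M[R]_N))
  (u ut : 'rV[R]_N -> \bar R) :
  open X -> ebounded X ->
  proper_elliptic X Th -> unif_cont_on X Th ->
  usc_on (closure X) u -> usc_on (closure X) ut ->
  subharmonic Th X u -> subharmonic (dual Th) X ut ->
  subharmonic (fun _ => Qtilde (N:=N)) X (fun x => (u x + ut x)%E).
Proof.
move=> oX _ pe uc _ _ su sut; split; first exact: usc_on_add su.1 sut.1.
move=> x0 Xx0 _ [phi [C2 le_phi eq_phi ->]]; split; first exact: hessian_sym C2.
have [r_le0|r_gt0] := leP (phi x0) 0; [by left|right => /=].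
rewrite leNgt; apply/negP => /(lamN_lt0 HN (hessian_sym C2))[c c0 Hneg].
(* In extended reals a sum is finite only if both terms are, as [+oo] plus [-oo] is [-oo]. *)
have [a0 [b0 [ua0 ub0 r_eq]]] :
    exists a0 b0 : R, [/\ u x0 = a0%:E, ut x0 = b0%:E & a0 + b0 = phi x0].
  by move: eq_phi; case: (u x0) => [a| |]; case: (ut x0) => [b| |] // [<-]; exists a, b.
(* The Hessian contributes [- c / 2] per unit of [sqn]; a Taylor error [c / 4] leaves the strict
   concavity [- c / 4]. *)
have c4 : 0 < c / 4 by rewrite divr_gt0.
have [r1 r10 [p taylor]] := C2_taylor HN C2 c4.
have [r2 r20 inX] := nbhs_eball (open_nbhs_nbhs (conj oX Xx0)).
have [r3 r30 below] := nbhs_eball le_phi.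
(* [opposite_jets] yields value at least [phi x0 / 4] and form at most [- c / 8]; both must beat
   [2 * e]. *)
pose e := Num.min (phi x0 / 8) (c / 16).
have e0 : 0 < e by rewrite lt_min !divr_gt0.
have er : e <= phi x0 / 8 by rewrite ge_min lexx.
have ec : e <= c / 16 by rewrite ge_min lexx orbT.
have [delta [delta0 close]] := uc e e0.
have q0 : 0 < 1 + sqn p + c / 4 by rewrite ltr_wpDl // addr_ge0 // sqn_ge0.
pose rho := Num.min (Num.min (Num.min r1 r2) (Num.min r3 (delta / 4)))
   (Num.min 1 (phi x0 / 4 / (1 + sqn p + c / 4))).
have rho0 : 0 < rho by rewrite !lt_min r10 r20 r30 ltr01 !divr_gt0.
have rho1 : rho <= r1 by rewrite !ge_min lexx.
have rho2 : rho <= r2 by rewrite !ge_min lexx !orbT.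
have rho3 : rho <= r3 by rewrite !ge_min lexx !orbT.
have rhod : rho <= delta / 4 by rewrite !ge_min lexx !orbT.
have rho_le1 : rho <= 1 by rewrite !ge_min lexx !orbT.
have rhoq : rho * (1 + sqn p + c / 4) <= phi x0 / 4.
  by rewrite -ler_pdivlMr // !ge_min lexx !orbT.
clearbody rho.
have subX : eball x0 rho `<=` X by exact: inX.
rewrite -r_eq in rhoq.
have hmax z (a b : R) : eball x0 rho z -> u z = a%:E -> ut z = b%:E ->
    a + b <= a0 + b0 + dot p (z - x0) - c / 4 * sqn (z - x0).
  move=> zb uz utz; have := below rho rho0 rho3 z zb; rewrite uz utz -EFinD lee_fin => h.
  have zr1 : sqn (z - x0) <= r1 ^+ 2.
    by apply: le_trans zb _; apply: ler_sqr_mono => //; exact: ltW.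
  have := taylor _ zr1; rewrite (addrC x0) subrK.
  by have := Hneg (z - x0); rewrite r_eq; lra.
have ab0 : 0 < a0 + b0 by rewrite r_eq.
have [z1 [z2 [a [b [A [B [[z1b z2b sA sB] [J1 J2 val AB]]]]]]]] :=
  opposite_jets HN rho0 (usc_on_subset subX su.1) (usc_on_subset subX sut.1)
    ua0 ub0 c4 ab0 hmax rho_le1 rhoq.
have X1 := subX _ z1b; have X2 := subX _ z2b.
have z12 : enorm (z1 - z2) < delta.
  apply: (@enorm_lt _ _ _ (rho + rho)); [by rewrite addr_ge0 // ltW|by lra|].
  have -> : z1 - z2 = (z1 - x0) + (x0 - z2) by rewrite addrA subrK.
  by apply: sqn_triangle; [exact: ltW|exact: ltW|exact: z1b|rewrite -sqnN opprB].
apply: (no_opposite_jets HN pe su sut X1 X2 (close _ _ X1 X2 z12) e0 sA sB J1 J2).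
  by rewrite r_eq in val; lra.
move=> v; apply: le_trans (AB v) _; apply: ler_wpM2r; first exact: sqn_ge0.
by lra.
Qed.
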